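(* Let $P$ be a law on environments $\omega=(\omega_x)_{x\in\mathbb Z}$ such that: (i) under $P$ the $\omega_x$, $x\in\mathbb Z$, are i.i.d. and there is a constant $c>0$ with $P(\omega_x\in[c,1-c])=1$; (ii) $E_P[\log\rho_0]<0$; (iii) $P(\omega_0<1/2)>0$ and $P(\omega_0>1/2)>0$. Let $\kappa>0$ be the unique positive solution of $E_P[\rho_0^\kappa]=1$. Then for $P$-a.e. environment $\omega$, $$\lim_{n\to\infty}P_\omega\Big(\max_{k\le 2n}|X_k|\ge n^\beta\,\Big|\,X_{2n}=0\Big)=\begin{cases}1 & \text{if }\beta<\frac{\kappa}{\kappa+1},\\ 0 & \text{if }\beta>\frac{\kappa}{\kappa+1}.\end{cases}$$
   Context: An environment is $\omega=(\omega_x)_{x\in\mathbb Z}\in(0,1)^{\mathbb Z}$; $P$ is a probability law on environments, with expectation $E_P$. Put $\rho_x=(1-\omega_x)/\omega_x$. Given $\omega$, the random walk in random environment $(X_n)_{n\ge0}$ is, under the quenched law $P_\omega$, the time-homogeneous Markov chain on $\mathbb Z$ with $X_0=0$ that from site $x$ jumps to $x+1$ with probability $\omega_x$ and to $x-1$ with probability $1-\omega_x$. Under (i)-(iii) the equation $E_P[\rho_0^\kappa]=1$ has a unique solution $\kappa>0$. *)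

(* Defs.v *)
From HB Require Import structures.
From mathcomp Require Import all_boot all_order all_algebra.
From mathcomp Require Import all_classical all_reals all_analysis.

Set Implicit Arguments.
Unset Strict Implicit.
Unset Printing Implicit Defensive.

Import Order.TTheory GRing.Theory Num.Theory.
Import numFieldNormedType.Exports.

Local Open Scope classical_set_scope.
Local Open Scope ring_scope.

Record environment (R : realType) := Environment {
  env_val :> int -> R ;
  env_valP : forall x, 0 < env_val x < 1 }.

Section environment_measurable.
Variable R : realType.

HB.instance Definition _ := gen_eqMixin (environment R).
HB.instance Definition _ := gen_choiceMixin (environment R).

Let half_in01 (x : int) : 0 < (2^-1 : R) < 1.
Proof. by rewrite invr_gt0 ltr0n invf_lt1 ?ltr1n ?ltr0n. Qed.

HB.instance Definition _ := isPointed.Build (environment R)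
  (Environment half_in01).

Definition env_cylinders : set (set (environment R)) :=
  \bigcup_(x in [set: int])
    preimage_set_system setT (fun w : environment R => w x) measurable.

(* The trace on (0,1)^Z of the product Borel sigma-algebra. *)
HB.instance Definition _ := @isMeasurable.Build (sigma_display env_cylinders)
  (environment R) <<s env_cylinders >>
  (@sigma_algebra0 _ setT env_cylinders)
  (@sigma_algebraC _ env_cylinders)
  (@sigma_algebra_bigcup _ setT env_cylinders).

End environment_measurable.

Definition mutually_independent d (T : measurableType d) (R : realType)
    (P : probability T R) (I : choiceType) (Y : I -> T -> R) : Prop :=
  forall (s : seq I) (B : I -> set R), uniq s ->
    (forall i, measurable (B i)) ->
    P (\bigcap_(i in [set` s]) (Y i @^-1` B i)) =
    (\prod_(i <- s) P (Y i @^-1` B i))%E.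

Definition identically_distributed d (T : measurableType d) (R : realType)
    (P : probability T R) (I : choiceType) (Y : I -> T -> R) : Prop :=
  forall (i j : I) (B : set R), measurable B ->
    P (Y i @^-1` B) = P (Y j @^-1` B).

Definition rho (R : realType) (w : environment R) (x : int) : R :=
  (1 - w x) / w x.

Definition step_prob (R : realType) (w : environment R) (x y : int) : R :=
  if y == x + 1 then w x else if y == x - 1 then 1 - w x else 0.

(* The Markov property is stated in product form, so that no conditioning on
   null events occurs. *)
Definition quenched_walk (R : realType) (w : environment R)
    d (S : measurableType d) (Q : probability S R) (X : nat -> S -> int) :
    Prop :=
  [/\ forall n x, measurable (X n @^-1` [set x]),
      Q [set s | X 0%N s = 0] = 1%E &
      forall (n : nat) (a : nat -> int) (y : int),
        Q [set s | (forall k, (k <= n)%N -> X k s = a k) /\ X n.+1 s = y] =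
        ((step_prob w (a n) y)%:E *
         Q [set s | forall k, (k <= n)%N -> X k s = a k])%E].

Definition cond_prob d (S : measurableType d) (R : realType)
    (Q : probability S R) (A B : set S) : R :=
  fine (Q (A `&` B)) / fine (Q B).

Definition max_abs (S : Type) (X : nat -> S -> int) (m : nat) (s : S) : nat :=
  \max_(k < m.+1) absz (X k s).

(* Main.v *)
(* The potential V, with V(x) - V(x-1) = ln (rho x), has drift to -oo.

   Displacement: to visit distance m and be back at 0 the walk must climb V by
   a multiple of m, which costs exp(-g m).

   Confinement: writing E[rho^a] < 1 for a < kappa, a union bound gives, for
   every q > 1/kappa, V(x) - V(y) <= C + q ln(1+|x|) - g (x - y) for y <= x.
   Hence [-m, m] contains no well deeper than q ln m, and an explicit
   superharmonic function shows that staying in [-m, m] for time n has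
   probability at most exp(C m - c n m^(-q)).

   Return: for q < 1/kappa, [0, m] contains a well of depth q ln m. Walking
   there, staying there and coming back gives
   P(X_2n = 0) >= exp(-C m - C n m^(-q)), and m = n^(kappa/(kappa+1)) balances
   the two terms.

   To avoid general product measures, ln(rho) is replaced by its value on a fine
   finite grid, so that the environment becomes a word of i.i.d. letters. *)
Require Import Defs.
From mathcomp Require Import all_boot all_order all_algebra.
From mathcomp Require Import all_classical all_reals all_analysis.
From mathcomp Require Import measurable_realfun ring lra zify.
Import Order.TTheory GRing.Theory Num.Theory.
Import numFieldNormedType.Exports.
Local Open Scope classical_set_scope.
Local Open Scope ring_scope.

(** * Walks as sums over finite paths *)

(** Write alpha = kappa/(kappa+1), so that 1 - alpha = alpha/kappa. With m = n^a the return costs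
    n^a + n^(1-aq), and some q < 1/kappa has 1 - aq <= a exactly when a > alpha. So the denominator
    is at least exp(-A n^a) for every a in (alpha, 1), and it suffices to beat n^a for one such a:
    the displacement cost n^beta does so if beta > alpha, the confinement cost n^(1 - beta q), q >
    1/kappa close to it, if beta < alpha. No constant has to be sharp.

    The environment enters through ellipticity, [drift_bound] above 1/kappa and [has_wells] below
    it. Both rest on the strict convexity of a |-> E[rho^a], which is 1 at 0 and at kappa. For a <
    kappa with qa > 1, Chernoff bounds are summable over the sites. For b > kappa, a climb of height
    q ln m has probability at least of order m^(-qb), and qb < 1 leaves enough disjoint blocks in
    [0, m] for one to succeed.

    Stopping times are avoided: a harmonic, superharmonic or subharmonic function is compared with
    the path sum by induction on the number of steps. *)

Section finite_paths.
Context {R : realType} {Z : eqType}.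
Variables (supp : Z -> seq Z) (k : Z -> Z -> R).

(** The test [A] receives the whole trajectory, starting point included; passing to
    [fun s => A (z :: s)] records the past, so estimates go by induction on the first step. The walk
    and the i.i.d. words are both instances. *)
Fixpoint path_prob (N : nat) (z : Z) (A : pred (seq Z)) : R :=
  if N is N'.+1 then
    \sum_(y <- supp z) k z y * path_prob N' y (fun s => A (z :: s))
  else (A [:: z])%:R.

Hypothesis k_ge0 : forall z y, 0 <= k z y.

Lemma path_prob_le N z (A B : pred (seq Z)) :
  (forall s, A (z :: s) -> B (z :: s)) -> path_prob N z A <= path_prob N z B.
Proof.
elim: N z A B => [|N IH] z A B AB /=.
  by case: (boolP (A [:: z])) => [/AB ->//|_]; rewrite ler0n.
by apply: ler_sum => y _; apply: ler_wpM2l => //; apply: IH => s; exact: AB.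
Qed.

Lemma eq_path_prob N z (A B : pred (seq Z)) :
  (forall s, A (z :: s) = B (z :: s)) -> path_prob N z A = path_prob N z B.
Proof.
by move=> AB; apply/eqP; rewrite eq_le !path_prob_le// => s; rewrite AB.
Qed.

Lemma path_prob_ge0 N z A : 0 <= path_prob N z A.
Proof.
elim: N z A => [|N IH] z A /=; first exact: ler0n.
by apply: sumr_ge0 => y _; exact: mulr_ge0.
Qed.

Lemma path_prob0 N z A : (forall s, ~~ A (z :: s)) -> path_prob N z A = 0.
Proof.
elim: N z A => [|N IH] z A nA /=; first by rewrite (negbTE (nA _)).
by rewrite big1// => y _; rewrite IH ?mulr0// => s; exact: nA.
Qed.

Hypothesis k_sum1 : forall z, \sum_(y <- supp z) k z y = 1.

Lemma path_prob_predC N z A :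
  path_prob N z (predC A) = 1 - path_prob N z A.
Proof.
elim: N z A => [|N IH] z A /=; first by case: (A [:: z]) => /=; lra.
transitivity (\sum_(y <- supp z)
    (k z y - k z y * path_prob N y (fun s => A (z :: s)))); last first.
  by rewrite sumrB k_sum1.
apply: eq_bigr => y _; rewrite -[X in X - _]mulr1 -mulrBr -IH.
by congr (_ * _); apply: eq_path_prob.
Qed.

Lemma path_prob_le1 N z A : path_prob N z A <= 1.
Proof.
have := path_prob_ge0 N z (predC A); rewrite path_prob_predC; lra.
Qed.

End finite_paths.

Section walk_paths.
Context {R : realType}.
Variable w : environment R.

Definition walk_supp (x : int) : seq int := [:: x + 1; x - 1].

Definition walk_prob := path_prob walk_supp (step_prob w).

Lemma env_gt0 x : 0 < w x. Proof. by case/andP: (env_valP w x). Qed.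

Lemma env_lt1 x : w x < 1. Proof. by case/andP: (env_valP w x). Qed.

Lemma step_prob_ge0 x y : 0 <= step_prob w x y.
Proof.
rewrite /step_prob; have := env_gt0 x; have := env_lt1 x.
by case: ifP => _; [|case: ifP => _]; lra.
Qed.

Lemma step_probR x : step_prob w x (x + 1) = w x.
Proof. by rewrite /step_prob eqxx. Qed.

Lemma step_probL x : step_prob w x (x - 1) = 1 - w x.
Proof. by rewrite /step_prob eqxx ifF//; apply/eqP; lia. Qed.

Lemma step_prob_sum1 x : \sum_(y <- walk_supp x) step_prob w x y = 1.
Proof. by rewrite !big_cons big_nil step_probR step_probL; lra. Qed.

Lemma walk_probS N x A : walk_prob N.+1 x A =
  w x * walk_prob N (x + 1) (fun s => A (x :: s)) +
  (1 - w x) * walk_prob N (x - 1) (fun s => A (x :: s)).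
Proof.
by rewrite /walk_prob /= !big_cons big_nil addr0 step_probR step_probL.
Qed.

Lemma walk_prob_ge0 N x A : 0 <= walk_prob N x A.
Proof. exact: path_prob_ge0 step_prob_ge0 _ _ _. Qed.

Lemma walk_prob_le1 N x A : walk_prob N x A <= 1.
Proof. exact: path_prob_le1 step_prob_ge0 step_prob_sum1 _ _ _. Qed.

Lemma walk_prob_le N x (A B : pred (seq int)) :
  (forall s, A (x :: s) -> B (x :: s)) -> walk_prob N x A <= walk_prob N x B.
Proof. exact: path_prob_le step_prob_ge0 _ _ _ _. Qed.

Lemma eq_walk_prob N x (A B : pred (seq int)) :
  (forall s, A (x :: s) = B (x :: s)) -> walk_prob N x A = walk_prob N x B.
Proof. exact: eq_path_prob step_prob_ge0 _ _ _ _. Qed.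

Lemma walk_prob0 N x A : (forall s, ~~ A (x :: s)) -> walk_prob N x A = 0.
Proof. exact: path_prob0. Qed.

Lemma rho_gt0 x : 0 < rho w x.
Proof. by rewrite /rho divr_gt0 ?subr_gt0 ?env_lt1 ?env_gt0. Qed.

(** The default 1 makes the empty list fail the test. *)
Definition ends_at0 (s : seq int) := last 1 s == 0.

(** Provides the potential, the scale function and the exponent of the confinement test function. *)
Lemma antidifference (f : int -> R) :
  exists F : int -> R, forall x, F (x + 1) = F x + f x.
Proof.
exists (fun x => match x with Posz n => \sum_(i < n) f i%:Z
   | Negz n => - \sum_(i < n.+1) f (Negz i) end).
case=> [n|[|n]].
- by rewrite -PoszD addn1 big_ord_recr.
- by rewrite (_ : Negz 0 + 1 = 0)//= big_ord0 big_ord_recr/= big_ord0 add0r addNr.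
- rewrite (_ : Negz n.+1 + 1 = Negz n); last by lia.
  by rewrite [in RHS]big_ord_recr/= opprD addrNK.
Qed.

(** * Scale function and gambler's ruin *)

Section scale_function.
Variables (e Sc : int -> R).
Hypothesis e_gt0 : forall x, 0 < e x.
Hypothesis e_rho : forall x, e x = rho w x * e (x - 1).
Hypothesis ScS : forall x, Sc (x + 1) = Sc x + e x.

Let scP x : Sc x = Sc (x - 1) + e (x - 1).
Proof. by rewrite -ScS subrK. Qed.

(** Here [e] plays the role of exp V. Since [w x * e x = (1 - w x) * e (x - 1)], the two increments
    of [Sc] at [x] balance. *)
Lemma scale_harmonic x : w x * Sc (x + 1) + (1 - w x) * Sc (x - 1) = Sc x.
Proof.
rewrite ScS (scP x) (e_rho x) /rho; have /lt0r_neq0 w0 := env_gt0 x.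
by field.
Qed.

Lemma scale_le x y : (x <= y)%R -> Sc x <= Sc y.
Proof.
move=> xy; have [n ->] : exists n : nat, y = x + n%:Z.
  by exists `|y - x|%N; lia.
elim: n {xy} => [|n IH]; first by rewrite addr0.
by rewrite -addn1 PoszD addrA ScS; apply: (le_trans IH); rewrite lerDl ltW.
Qed.

Lemma scale_lt x y : (x < y)%R -> Sc x < Sc y.
Proof.
move=> xy; apply: (@lt_le_trans _ _ (Sc (x + 1))); first by rewrite ScS ltrDl.
by apply: scale_le; lia.
Qed.

Lemma scale_bound x (n : nat) B :
  (forall j : nat, (j < n)%N -> e (x + j%:Z) <= B) ->
  Sc (x + n%:Z) - Sc x <= n%:R * B.
Proof.
elim: n => [|n IH] eB; first by rewrite addr0 subrr mul0r.
rewrite -[n.+1]addn1 PoszD addrA ScS natrD mulrDl mul1r.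
have := eB n (ltnSn _); have := IH (fun j jn => eB j (ltnW jn)); lra.
Qed.

(** The right side is the probability of hitting [a] before [M + 1]. The bound on [x + N] keeps the
    walk at or below [M + 1], where this harmonic function is nonnegative, so induction on [N]
    replaces optional stopping. *)
Lemma hit_below_le N x (a M : int) : (x + N%:Z <= M + 1)%R -> (a <= M)%R ->
  walk_prob N x (has (fun y => (y <= a)%R)) <=
  (Sc (M + 1) - Sc x) / (Sc (M + 1) - Sc a).
Proof.
move=> + aM; have ScM : 0 < Sc (M + 1) - Sc a.
  by rewrite subr_gt0 scale_lt//; lia.
elim: N x => [|N IH] x xM; have [xa|xa] := leP x a.
- apply: le_trans (walk_prob_le1 _ _ _) _.
  by rewrite ler_pdivlMr// mul1r lerD2l lerN2 scale_le.
- rewrite /walk_prob/= (lt_geF xa)/=.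
  by apply: divr_ge0; [rewrite subr_ge0 scale_le//; lia|exact: ltW].
- apply: le_trans (walk_prob_le1 _ _ _) _.
  by rewrite ler_pdivlMr// mul1r lerD2l lerN2 scale_le.
- rewrite walk_probS.
  have E (y : int) : walk_prob N y (fun s => has (fun z => (z <= a)%R) (x :: s)) =
      walk_prob N y (has (fun z => (z <= a)%R)).
    by apply: eq_walk_prob => s /=; rewrite (lt_geF xa).
  rewrite !E.
  have H1 := IH (x + 1) ltac:(lia); have H2 := IH (x - 1) ltac:(lia).
  have w0 := env_gt0 x; have w1 := env_lt1 x.
  apply: (@le_trans _ _ (w x * ((Sc (M + 1) - Sc (x + 1)) / (Sc (M + 1) - Sc a))
     + (1 - w x) * ((Sc (M + 1) - Sc (x - 1)) / (Sc (M + 1) - Sc a)))).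
    by apply: lerD; apply: ler_wpM2l => //; lra.
  by rewrite -[in leRHS](scale_harmonic x) le_eqVlt; apply/orP; left; apply/eqP; field; exact: lt0r_neq0.
Qed.

(** The bound does not depend on [x], so nothing is lost while the walk is below [m]; once at [m] or
    above, ending at 0 requires a descent to 0, which [hit_below_le] controls. *)
Lemma hit_above_end0_le N x (m M : int) : (x + N%:Z <= M + 1)%R ->
  (0 < m)%R -> (m <= M + 1)%R ->
  walk_prob N x (fun s => has (fun y => (m <= y)%R) s && ends_at0 s) <=
  (Sc (M + 1) - Sc m) / (Sc (M + 1) - Sc 0).
Proof.
move=> + m0 mM; have ScM : 0 < Sc (M + 1) - Sc 0.
  by rewrite subr_gt0 scale_lt//; lia.
elim: N x => [|N IH] x xM; have [xm|xm] := leP m x.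
- rewrite /walk_prob/= /ends_at0/= xm gt_eqF; last by lia.
  by apply: divr_ge0; [rewrite subr_ge0 scale_le//; lia|exact: ltW].
- rewrite /walk_prob/= /ends_at0/= (lt_geF xm)/=.
  by apply: divr_ge0; [rewrite subr_ge0 scale_le//; lia|exact: ltW].
- apply: le_trans (_ : _ <= walk_prob N.+1 x (has (fun y => (y <= 0)%R))) _.
    apply: walk_prob_le => s /andP[_ /eqP se]; apply/hasP; exists 0 => //.
    by have := mem_last x s; rewrite (_ : last x s = 0).
  apply: le_trans (@hit_below_le _ _ 0 M xM _) _; first by lia.
  apply: ler_wpM2r; first by rewrite invr_ge0 ltW.
  by rewrite lerD2l lerN2 scale_le.
- rewrite walk_probS.
  pose A s := has (fun y => (m <= y)%R) s && ends_at0 s.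
  have E (y : int) : walk_prob N y (fun s => A (x :: s)) <=
      walk_prob N y A.
    apply: walk_prob_le => s; rewrite /A/= (lt_geF xm)/=.
    by rewrite /ends_at0.
  have H1 := le_trans (E _) (IH (x + 1) ltac:(lia)).
  have H2 := le_trans (E _) (IH (x - 1) ltac:(lia)).
  have w0 := env_gt0 x; have w1 := env_lt1 x.
  set q := (X in _ <= X) in H1 H2 *.
  apply: (@le_trans _ _ (w x * q + (1 - w x) * q)); last by rewrite -mulrDl addrC subrK mul1r.
  by apply: lerD; apply: ler_wpM2l; [lra|exact: H1|lra|exact: H2].
Qed.

End scale_function.

(** [h] dominates the indicator of the box and loses a factor [1 - lam] in mean at each step made
    inside it. *)
Lemma walk_stay_le (lam : R) (m : int) (h : int -> R) :
  0 <= 1 - lam ->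
  (forall x, 0 <= h x) -> (forall x, (`|x| <= m)%R -> 1 <= h x) ->
  (forall x, (`|x| <= m)%R ->
     w x * h (x + 1) + (1 - w x) * h (x - 1) <= (1 - lam) * h x) ->
  forall N x, walk_prob N x (all (fun y => (`|y| <= m)%R)) <=
    (1 - lam) ^+ N * h x.
Proof.
move=> lam1 h0 h1 hs; elim=> [|N IH] x; have [xm|xm] := leP `|x|%R m.
- by rewrite /walk_prob/= xm expr0 mul1r h1.
- by rewrite /walk_prob/= (lt_geF xm)/= mulr_ge0// exprn_ge0.
- rewrite walk_probS.
  have E (y : int) : walk_prob N y (fun s => all (fun y => (`|y| <= m)%R) (x :: s)) =
      walk_prob N y (all (fun y => (`|y| <= m)%R)).
    by apply: eq_walk_prob => s /=; rewrite xm.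
  rewrite !E.
  have w0 := env_gt0 x; have w1 := env_lt1 x.
  apply: (@le_trans _ _ (w x * ((1 - lam) ^+ N * h (x + 1)) +
    (1 - w x) * ((1 - lam) ^+ N * h (x - 1)))).
    by apply: lerD; apply: ler_wpM2l => //; lra.
  rewrite exprSr -mulrA [X in X <= _](_ : _ = (1 - lam) ^+ N * (w x * h (x + 1) + (1 - w x) * h (x - 1))); last by ring.
  by rewrite ler_wpM2l ?exprn_ge0// hs.
- rewrite walk_prob0; first by rewrite mulr_ge0// exprn_ge0.
  by move=> s /=; rewrite (lt_geF xm).
Qed.

(** * Lower bounds for the return probability *)

Section return_probability.
Variable c : R.
Hypothesis c_gt0 : 0 < c.
Hypothesis w_ell : forall x, c <= w x <= 1 - c.

Let retE (x y : int) N : walk_prob N y (fun s => ends_at0 (x :: s)) =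
  walk_prob N y ends_at0.
Proof. by apply: eq_walk_prob => s. Qed.

Lemma ret_stepR N x :
  c * walk_prob N (x + 1) ends_at0 <= walk_prob N.+1 x ends_at0.
Proof.
rewrite walk_probS !retE; have /andP[w0 w1] := w_ell x.
have wx0 := env_gt0 x; have wx1 := env_lt1 x.
apply: (@le_trans _ _ (w x * walk_prob N (x + 1) ends_at0)).
  by rewrite ler_wpM2r// walk_prob_ge0.
by rewrite lerDl mulr_ge0 ?walk_prob_ge0//; lra.
Qed.

Lemma ret_stepL N x :
  c * walk_prob N (x - 1) ends_at0 <= walk_prob N.+1 x ends_at0.
Proof.
rewrite walk_probS !retE; have /andP[w0 w1] := w_ell x.
have wx0 := env_gt0 x; have wx1 := env_lt1 x.
apply: (@le_trans _ _ ((1 - w x) * walk_prob N (x - 1) ends_at0)).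
  by rewrite ler_wpM2r ?walk_prob_ge0// lerBrDr addrC -lerBrDr.
by rewrite lerDr mulr_ge0 ?walk_prob_ge0// ltW.
Qed.

(** One explicit path is followed: step towards 0, and from 0 to 1. Left-over time is spent
    oscillating between 0 and 1; parity decides that the path ends at 0. *)
Lemma ret_direct_ge t x : (`|x| <= t)%N -> odd `|x| = odd t ->
  c ^+ t <= walk_prob t x ends_at0.
Proof.
elim: t x => [|t IH] x xt ox.
  have -> : x = 0 by lia.
  by rewrite expr0.
have [x0|x0] := leP x 0.
- rewrite exprS; apply: le_trans (ret_stepR _ _).
  by apply: ler_wpM2l; [exact: ltW|apply: IH; lia].
- rewrite exprS; apply: le_trans (ret_stepL _ _).
  by apply: ler_wpM2l; [exact: ltW|apply: IH; lia].
Qed.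

(** After [N] steps [t] are left for a direct way home: within distance [t] it costs at most
    [c ^+ t], and farther away [h] is at most 0 and claims nothing. *)
Lemma ret_subharmonic_ge (del : R) (t : nat) (h : int -> R) :
  0 <= 1 - del -> (forall x, h x <= 1) ->
  (forall x, (t < `|x|)%N -> h x <= 0) ->
  (forall x, (1 - del) * h x <= w x * h (x + 1) + (1 - w x) * h (x - 1)) ->
  forall N x, odd `|x| = odd (N + t) ->
  c ^+ t * ((1 - del) ^+ N * h x) <= walk_prob (N + t) x ends_at0.
Proof.
move=> del1 h1 h0 hs; have ct : 0 <= c ^+ t by rewrite exprn_ge0 ?ltW.
elim=> [|N IH] x ox.
  rewrite expr0 mul1r; have [xt|xt] := leqP `|x| t.
    by apply: le_trans (@ret_direct_ge t x xt ox); rewrite ler_piMr.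
  by apply: le_trans (walk_prob_ge0 _ _ _); rewrite mulr_ge0_le0// h0.
rewrite addSn walk_probS !retE.
have H1 := IH (x + 1) ltac:(lia); have H2 := IH (x - 1) ltac:(lia).
have w0 := env_gt0 x; have w1 := env_lt1 x.
apply: (@le_trans _ _ (w x * (c ^+ t * ((1 - del) ^+ N * h (x + 1))) +
    (1 - w x) * (c ^+ t * ((1 - del) ^+ N * h (x - 1))))); last first.
  by apply: lerD; apply: ler_wpM2l => //; lra.
rewrite exprSr -mulrA [leRHS](_ : _ = c ^+ t * ((1 - del) ^+ N * (w x * h (x + 1) + (1 - w x) * h (x - 1)))); last by ring.
by rewrite ler_wpM2l// ler_wpM2l ?exprn_ge0.
Qed.

Lemma ret_reach_ge N (b : nat) :
  c ^+ b * walk_prob N b%:Z ends_at0 <= walk_prob (b + N) 0 ends_at0.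
Proof.
suff H j : (j <= b)%N ->
    c ^+ j * walk_prob N b%:Z ends_at0 <= walk_prob (j + N) (b - j)%:Z ends_at0.
  by have := H b (leqnn _); rewrite subnn.
elim: j => [|j IH] jb; first by rewrite expr0 mul1r subn0.
rewrite exprS -mulrA addSn; apply: le_trans (ret_stepR _ _).
rewrite (_ : (b - j.+1)%:Z + 1 = (b - j)%:Z); last by lia.
by apply: ler_wpM2l; [exact: ltW|exact: IH (ltnW jb)].
Qed.

End return_probability.

End walk_paths.

(** * Potential, wells and return probabilities *)

Section well.
Context {R : realType}.
Variables (w : environment R) (e Sc : int -> R).
Hypothesis e_gt0 : forall x, 0 < e x.
Hypothesis e_rho : forall x, e x = rho w x * e (x - 1).
Hypothesis ScS : forall x, Sc (x + 1) = Sc x + e x.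
Variables bot b top : int.
Hypothesis bot_b : (bot < b)%R.
Hypothesis b_top : (b < top)%R.

(* The probability, started at x, of visiting b before leaving ]bot, top[. *)
Definition well_hit (x : int) : R :=
  if (x <= bot)%R || (top <= x)%R then 0
  else if (b <= x)%R then (Sc top - Sc x) / (Sc top - Sc b)
  else (Sc x - Sc bot) / (Sc b - Sc bot).

Let rangeR x : (b < x)%R -> ~~ ((x <= bot)%R || (top <= x)%R) ->
  [/\ (b <= x <= top)%R, (b <= x + 1 <= top)%R & (b <= x - 1 <= top)%R].
Proof. by move=> *; split; lia. Qed.

Let rangeL x : (x < b)%R -> ~~ ((x <= bot)%R || (top <= x)%R) ->
  [/\ (bot <= x <= b)%R, (bot <= x + 1 <= b)%R & (bot <= x - 1 <= b)%R].
Proof. by move=> *; split; lia. Qed.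

Let range_center :
  [/\ (b <= b + 1)%R, (b + 1 <= top)%R, (bot <= b - 1)%R & (b - 1 <= b)%R].
Proof. by split; lia. Qed.

Let right_gt0 : 0 < Sc top - Sc b.
Proof. by rewrite subr_gt0 (scale_lt e). Qed.

Let left_gt0 : 0 < Sc b - Sc bot.
Proof. by rewrite subr_gt0 (scale_lt e). Qed.

Let well_hitR x : (b <= x)%R -> (x <= top)%R ->
  well_hit x = (Sc top - Sc x) / (Sc top - Sc b).
Proof.
move=> bx; rewrite le_eqVlt => /orP[/eqP->|xt]; rewrite /well_hit.
  by rewrite lexx orbT subrr mul0r.
by rewrite bx ifF//; apply/negbTE; lia.
Qed.

Let well_hitL x : (bot <= x)%R -> (x <= b)%R ->
  well_hit x = (Sc x - Sc bot) / (Sc b - Sc bot).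
Proof.
rewrite le_eqVlt => /orP[/eqP<-|bx] xb; rewrite /well_hit.
  by rewrite lexx subrr mul0r.
rewrite ifF; last by apply/negbTE; lia.
case: ifP => // bx'; have -> : x = b by lia.
by rewrite !divff// lt0r_neq0.
Qed.

Lemma well_hit_center : well_hit b = 1.
Proof. by rewrite well_hitR ?lexx 1?ltW// divff// lt0r_neq0. Qed.

Lemma well_hit_out x : (x <= bot)%R || (top <= x)%R -> well_hit x = 0.
Proof. by rewrite /well_hit => ->. Qed.

Lemma well_hit_ge0 x : 0 <= well_hit x.
Proof.
have [xb|bx] := leP x bot; first by rewrite well_hit_out// xb.
have [tx|xt] := leP top x; first by rewrite well_hit_out// tx orbT.
have [xb|/ltW xb] := leP b x.
  rewrite well_hitR//; last exact: ltW.
  by rewrite divr_ge0 ?subr_ge0 ?(scale_le e Sc)// ltW.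
rewrite well_hitL//; last exact: ltW.
by rewrite divr_ge0 ?subr_ge0 ?(scale_le e Sc)// ltW.
Qed.

Lemma well_hit_le1 x : well_hit x <= 1.
Proof.
have [xb|bx] := leP x bot; first by rewrite well_hit_out// xb.
have [tx|xt] := leP top x; first by rewrite well_hit_out// tx orbT.
have [xb|/ltW xb] := leP b x.
  rewrite well_hitR//; last exact: ltW.
  by rewrite ler_pdivrMr// mul1r lerD2l lerN2 (scale_le e).
rewrite well_hitL//; last exact: ltW.
by rewrite ler_pdivrMr// mul1r lerD2r (scale_le e).
Qed.

(** Away from [b] the function is affine in [Sc], hence harmonic, or it vanishes. At [b] itself, a
    step to the right fails to come back with probability [e b / (Sc top - Sc b)], and similarly on
    the left; [del] bounds both losses. *)
Lemma well_hit_subharmonic del : 0 <= del ->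
  e b <= del * (Sc top - Sc b) -> e (b - 1) <= del * (Sc b - Sc bot) ->
  forall x, (1 - del) * well_hit x <=
    w x * well_hit (x + 1) + (1 - w x) * well_hit (x - 1).
Proof.
move=> del0 eR eL x; have w0 := env_gt0 w x; have w1 := env_lt1 w x.
have w1' : 0 <= 1 - w x by lra.
have harm := scale_harmonic w e Sc e_rho ScS x.
have nR := lt0r_neq0 right_gt0; have nL := lt0r_neq0 left_gt0.
case: (boolP ((x <= bot)%R || (top <= x)%R)) => [xo|xi].
  rewrite (well_hit_out x xo) mulr0.
  by rewrite addr_ge0// mulr_ge0 ?well_hit_ge0// ltW.
have decr : (1 - del) * well_hit x <= well_hit x.
  by rewrite ler_piMl ?well_hit_ge0//; lra.
have [bx|xb|xb] := ltgtP b x.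
- apply: (le_trans decr).
  have [/andP[b0 b1] /andP[b2 b3] /andP[b4 b5]] := rangeR x bx xi.
  rewrite (well_hitR x)// (well_hitR (x + 1))// (well_hitR (x - 1))//.
  by rewrite -[in leLHS]harm le_eqVlt; apply/orP; left; apply/eqP; field.
- apply: (le_trans decr).
  have [/andP[b0 b1] /andP[b2 b3] /andP[b4 b5]] := rangeL x xb xi.
  rewrite (well_hitL x)// (well_hitL (x + 1))// (well_hitL (x - 1))//.
  by rewrite -[in leLHS]harm le_eqVlt; apply/orP; left; apply/eqP; field.
- rewrite -xb well_hit_center mulr1 in w0 w1 w1' *.
  have [b0 b1 b2 b3] := range_center.
  rewrite (well_hitR (b + 1))// (well_hitL (b - 1))//.
  have ScP : Sc (b - 1) = Sc b - e (b - 1).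
    by apply/eqP; rewrite -subr_eq opprK -ScS subrK.
  rewrite ScS ScP.
  have -> : (Sc top - (Sc b + e b)) / (Sc top - Sc b) =
      1 - e b / (Sc top - Sc b) by field.
  have -> : (Sc b - e (b - 1) - Sc bot) / (Sc b - Sc bot) =
      1 - e (b - 1) / (Sc b - Sc bot) by field.
  have HR : e b / (Sc top - Sc b) <= del by rewrite ler_pdivrMr.
  have HL : e (b - 1) / (Sc b - Sc bot) <= del by rewrite ler_pdivrMr.
  rewrite [leLHS](_ : _ = w b * (1 - del) + (1 - w b) * (1 - del)); last by ring.
  by apply: lerD; apply: ler_wpM2l => //; rewrite ?lerD2l ?lerN2// ltW.
Qed.

End well.

Section potential.
Context {R : realType}.
Variable w : environment R.

Definition log_sum_down (x : int) (l : nat) : R :=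
  \sum_(i < l) ln (rho w (x - i%:Z)).

Definition log_sum_up (x : int) (l : nat) : R :=
  \sum_(i < l) ln (rho w (x + i%:Z)).

Definition drift_bound (q : R) : Prop :=
  exists C g : R, 0 < g /\ forall x l,
    log_sum_down x l <= C + q * ln (1 + `|x|%N%:R) - g * l%:R.

(** Only the right wall is requested: V rises by q ln m from b to b + l. The left wall is supplied
    by the drift, see [near_well]. *)
Definition has_wells (q : R) : Prop :=
  exists m0 : nat, forall m : nat, (m0 <= m)%N ->
    exists b l : nat, (b + l <= m)%N /\
      q * ln m%:R <= log_sum_up (b%:Z + 1) l.

Lemma potential_exists : exists V : int -> R,
  forall x, V x = V (x - 1) + ln (rho w x).
Proof.
have [F FE] := antidifference (fun x => ln (rho w (x + 1))).
by exists F => x; rewrite -[in LHS](subrK 1 x) FE subrK.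
Qed.

Section with_potential.
Variable V : int -> R.
Hypothesis VE : forall x, V x = V (x - 1) + ln (rho w x).

Lemma potential_down x l : V x - V (x - l%:Z) = log_sum_down x l.
Proof.
elim: l => [|l IH]; first by rewrite subr0 subrr /log_sum_down big_ord0.
rewrite /log_sum_down big_ord_recr/= -/(log_sum_down x l) -IH (VE (x - l%:Z)).
by rewrite (_ : x - l%:Z - 1 = x - l.+1%:Z); [ring|lia].
Qed.

Lemma potential_up x l : V (x - 1 + l%:Z) - V (x - 1) = log_sum_up x l.
Proof.
elim: l => [|l IH]; first by rewrite addr0 subrr /log_sum_up big_ord0.
rewrite /log_sum_up big_ord_recr/= -/(log_sum_up x l) -IH.
rewrite (VE (x - 1 + l.+1%:Z)) (_ : x - 1 + l.+1%:Z - 1 = x - 1 + l%:Z); last by lia.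
by rewrite (_ : x - 1 + l.+1%:Z = x + l%:Z); [ring|lia].
Qed.

Lemma exp_potential x : expR (V x) = rho w x * expR (V (x - 1)).
Proof. by rewrite VE expRD lnK ?posrE ?rho_gt0// mulrC. Qed.

End with_potential.

(** The powers of [c] pay for the [b] steps to the bottom of the well and for the [m.+1] steps home;
    the powers of [1 - del] pay for the excursions in between. *)
Lemma return_prob_ge (c del : R) (m n b l : nat) :
  0 < c -> (forall x, c <= w x <= 1 - c) -> 0 <= del <= 1 ->
  (b + l <= m)%N -> (m.+1 <= n)%N ->
  expR (- log_sum_up (b%:Z + 1) l) <= del ->
  expR (log_sum_down (b%:Z - 1) m) <= del ->
  c ^+ (2 * m.+1) * (1 - del) ^+ (2 * n) <= walk_prob w (2 * n) 0 ends_at0.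
Proof.
move=> c0 wc /andP[del0 del1] blm mn eup edown.
have [V VE] := potential_exists.
pose e x := expR (V x).
have e0 x : 0 < e x by exact: expR_gt0.
have eE x : e x = rho w x * e (x - 1) by exact: exp_potential.
have [Sc ScS] := antidifference e.
(* The walls are placed so that the single terms [e (b + l)] and [e bot] of the scale sums are
   already as large as [del] requires, and so that the well lies within distance [m.+1] of 0. *)
pose bot : int := b%:Z - 1 - m%:Z; pose top : int := b%:Z + l%:Z + 1.
have bb : (bot < b%:Z)%R by rewrite /bot; lia.
have bt : (b%:Z < top)%R by rewrite /top; lia.
pose h := well_hit Sc bot b%:Z top.
have hs : forall x, (1 - del) * h x <= w x * h (x + 1) + (1 - w x) * h (x - 1).
  apply: (well_hit_subharmonic w e Sc e0 eE ScS _ _ _ bb bt del del0).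
  - apply: (@le_trans _ _ (del * e (b%:Z + l%:Z))).
      rewrite -ler_pdivrMr ?e0// -expRB.
      move: eup; rewrite -(potential_up V VE) (_ : b%:Z + 1 - 1 = b%:Z); last by lia.
      by rewrite opprB.
    rewrite ler_wpM2l//.
    have := scale_le e Sc e0 ScS b%:Z (b%:Z + l%:Z) ltac:(lia).
    by rewrite /top ScS; lra.
  - apply: (@le_trans _ _ (del * e bot)).
      rewrite -ler_pdivrMr ?e0// -expRB.
      by move: edown; rewrite -(potential_down V VE).
    rewrite ler_wpM2l//.
    have := scale_le e Sc e0 ScS (bot + 1) b%:Z ltac:(lia).
    by rewrite ScS; lra.
have cm : c <= 1 by have := wc 0; have := env_lt1 w 0; lra.
have N_E : (2 * n = b + ((2 * n - b - m.+1) + m.+1))%N by lia.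
rewrite [in leRHS]N_E.
apply: le_trans (ret_reach_ge w c c0 wc _ b).
have d1 : 0 <= 1 - del by lra.
have hout x : (m.+1 < `|x|)%N -> h x <= 0.
  by move=> xm; rewrite /h well_hit_out//; rewrite /bot /top; lia.
have := ret_subharmonic_ge w c c0 wc del m.+1 h d1
  (well_hit_le1 e Sc e0 ScS _ _ _ bb bt) hout hs (2 * n - b - m.+1) b%:Z ltac:(lia).
rewrite {1}/h (well_hit_center e Sc e0 ScS _ _ _ bb bt) mulr1 => H.
have cb : 0 <= c ^+ b by rewrite exprn_ge0// ltW.
apply: le_trans (ler_wpM2l cb H).
rewrite mulrA -exprD; apply: ler_pM.
- by rewrite exprn_ge0// ltW.
- by rewrite exprn_ge0.
- by apply: ler_wiXn2l; [exact: ltW| |lia].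
- by apply: ler_wiXn2l; [|lra|lia].
Qed.

End potential.

(** * Confinement and displacement *)

Section union_bound.
Context {R : realType}.
Variable w : environment R.

Lemma walk_probU N x A B :
  walk_prob w N x (predU A B) <= walk_prob w N x A + walk_prob w N x B.
Proof.
elim: N x A B => [|N IH] x A B.
  by rewrite /walk_prob/=; case: (A _); case: (B _) => /=; lra.
rewrite !walk_probS; have w0 := env_gt0 w x; have w1 := env_lt1 w x.
set A' := fun s => A (x :: s); set B' := fun s => B (x :: s).
apply: (@le_trans _ _ (w x * (walk_prob w N (x + 1) A' + walk_prob w N (x + 1) B') +
   (1 - w x) * (walk_prob w N (x - 1) A' + walk_prob w N (x - 1) B'))).
  by apply: lerD; apply: ler_wpM2l; [exact: ltW|exact: IH|rewrite subr_ge0 ltW|exact: IH].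
by rewrite le_eqVlt; apply/orP; left; apply/eqP; ring.
Qed.

End union_bound.

Section displacement.
Context {R : realType}.
Variables (w : environment R) (C g q : R).
Hypothesis g_gt0 : 0 < g.
Hypothesis q_ge0 : 0 <= q.
Hypothesis drift : forall x l,
  log_sum_down w x l <= C + q * ln (1 + `|x|%N%:R) - g * l%:R.

Let ln_mono (a b : nat) : (a <= b)%N -> ln (1 + a%:R) <= ln (1 + b%:R) :> R.
Proof.
move=> ab; rewrite ler_ln ?posrE ?ltr_wpDr ?ler0n ?ltr01//.
by rewrite lerD2l ler_nat.
Qed.

(** A visit to the right pays on the way back to 0, a visit to the left pays on the way out: in both
    cases V is climbed over a length at least m. Hence the factor 2 and, on the left, no use of the
    return. *)
Lemma displaced_return_le (n m : nat) : (0 < m)%N -> (m <= (2 * n).+1)%N ->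
  walk_prob w (2 * n) 0
    (fun s => has (fun y => m <= `|y|)%N s && ends_at0 s) <=
  2 * (2 * n).+1%:R * expR (C + q * ln (1 + (2 * n)%:R) - g * m%:R).
Proof.
move=> m0 mn; set B := expR _.
have [V VE] := potential_exists w.
pose e x := expR (V x).
have e0 x : 0 < e x by exact: expR_gt0.
have eE x : e x = rho w x * e (x - 1) by exact: exp_potential.
have [Sc ScS] := antidifference e.
(* In [2 * n] steps from 0 the level [M + 1] is out of reach, as the ruin bounds demand. *)
pose M : int := (2 * n)%N%:Z.
have eB x (l j : nat) : x = j%:Z -> (m <= l)%N -> (j <= 2 * n)%N ->
    e x <= e (x - l%:Z) * B.
  move=> xj ml jn; rewrite mulrC -ler_pdivrMr ?e0// -expRB ler_expR.
  rewrite (potential_down w V VE); apply: (le_trans (drift _ _)).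
  rewrite xj absz_nat lerD//; last by rewrite lerN2 ler_wpM2l ?ler_nat// ltW.
  by rewrite lerD2l ler_wpM2l// ln_mono.
(* The numerator has at most [(2 * n).+1] terms; of the denominator only its first term [e y] is
   kept. *)
have ratio (x y : int) (k : nat) : (y <= M)%R -> x + k%:Z = M + 1 -> (k <= (2 * n).+1)%N ->
    (forall j : nat, (j < k)%N -> e (x + j%:Z) <= e y * B) ->
    (Sc (M + 1) - Sc x) / (Sc (M + 1) - Sc y) <= (2 * n).+1%:R * B.
  move=> yM xk kn eb.
  have yM1 : (y + 1 <= M + 1)%R by lia.
  have D0 : e y <= Sc (M + 1) - Sc y.
    by have := scale_le e Sc e0 ScS _ _ yM1; rewrite ScS; lra.
  have D1 : 0 < Sc (M + 1) - Sc y by apply: lt_le_trans D0.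
  rewrite ler_pdivrMr// -xk.
  apply: (le_trans (scale_bound e Sc ScS _ _ _ eb)).
  rewrite xk; apply: (@le_trans _ _ ((2 * n).+1%:R * (e y * B))).
    by apply: ler_wpM2r; rewrite ?ler_nat// mulr_ge0 ?expR_ge0.
  rewrite -mulrA ler_wpM2l ?ler0n// mulrC ler_wpM2l ?expR_ge0//.
have R0 : (Sc (M + 1) - Sc m%:Z) / (Sc (M + 1) - Sc 0) <= (2 * n).+1%:R * B.
  apply: (ratio _ _ ((2 * n).+1 - m)%N); [by rewrite /M|rewrite /M; lia|lia|].
  move=> j jn; have -> : 0 = m%:Z + j%:Z - (m + j)%N%:Z by lia.
  by apply: (eB _ (m + j)%N (m + j)%N); lia.
have L0 : (Sc (M + 1) - Sc 0) / (Sc (M + 1) - Sc (- m%:Z)) <= (2 * n).+1%:R * B.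
  apply: (ratio _ _ ((2 * n).+1)%N); [by rewrite /M; lia|rewrite /M; lia|lia|].
  move=> j jn; have -> : - m%:Z = 0 + j%:Z - (m + j)%N%:Z by lia.
  by apply: (eB _ (m + j)%N j); lia.
have r1 : (0 + (2 * n)%N%:Z <= M + 1)%R by rewrite /M; lia.
have r2 : (0 < m%:Z)%R by lia.
have r3 : (m%:Z <= M + 1)%R by rewrite /M; lia.
have r4 : (- m%:Z <= M)%R by rewrite /M; lia.
have HR := hit_above_end0_le w e Sc e0 eE ScS (2 * n) 0 m%:Z M r1 r2 r3.
have HL := hit_below_le w e Sc e0 eE ScS (2 * n) 0 (- m%:Z) M r1 r4.
rewrite -mulrA mulr_natl mulr2n.
apply: le_trans (lerD (le_trans HR R0) (le_trans HL L0)).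
apply: le_trans (walk_probU _ _ _ _ _); apply: walk_prob_le => s.
move=> /andP[hs s0]; have /hasP[y yt my] := hs.
have [y0|y0] := leP 0 y.
  apply/orP; left; apply/andP; split; [apply/hasP; exists y => //|exact: s0].
  by move: my y0; clear; lia.
apply/orP; right; apply/hasP; exists y => //.
by move: my y0; clear; lia.
Qed.

(** This is the supremum over l of exp(V(x) - V(x - l) + g l): the highest climb ending at x, with a
    bonus g per step. The drift hypothesis makes it finite, and lengthening a climb by one step
    gives [height_step], whose factor exp g is the slack that confinement needs. *)
Definition height (x : int) : R :=
  sup (range (fun l : nat => expR (log_sum_down w x l + g * l%:R))).

Let height_term x (l : nat) : expR (log_sum_down w x l + g * l%:R) <=
  expR (C + q * ln (1 + `|x|%N%:R)).
Proof. by rewrite ler_expR -lerBrDr; exact: drift. Qed.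

Lemma height_ub x l : expR (log_sum_down w x l + g * l%:R) <= height x.
Proof.
apply: ub_le_sup; last by exists l.
by exists (expR (C + q * ln (1 + `|x|%N%:R))) => _ [k _ <-].
Qed.

Lemma height_le x : height x <= expR (C + q * ln (1 + `|x|%N%:R)).
Proof.
apply: ge_sup; first by exists (expR (log_sum_down w x 0 + g * 0%:R)), 0%N.
by move=> _ [k _ <-].
Qed.

Lemma height_ge1 x : 1 <= height x.
Proof.
apply: le_trans (height_ub x 0).
by rewrite /log_sum_down big_ord0 mulr0 addr0 expR0.
Qed.

Lemma height_step x : rho w x * expR g * height (x - 1) <= height x.
Proof.
have rg : 0 < rho w x * expR g by rewrite mulr_gt0 ?rho_gt0 ?expR_gt0.
rewrite mulrC -ler_pdivlMr//.
apply: ge_sup; first by exists (expR (log_sum_down w (x - 1) 0 + g * 0%:R)), 0%N.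
move=> _ [l _ <-]; rewrite ler_pdivlMr//; apply: le_trans (height_ub x l.+1).
rewrite -[rho w x]lnK ?posrE ?rho_gt0// -!expRD ler_expR.
rewrite /log_sum_down big_ord_recl/= subr0.
rewrite [X in _ <= ln _ + X + _](_ : _ = \sum_(i < l) ln (rho w (x - 1 - i%:Z))).
  set t := \sum_(i < l) _; move: t => t.
  rewrite -natr1 mulrDr mulr1 le_eqVlt; apply/orP; left; apply/eqP; ring.
apply: eq_bigr => i _; rewrite /bump/= (_ : x - _ = x - 1 - i%:Z)//.
by clear; lia.
Qed.

(** [c] bounds [w x] from below; one factor 1 - exp(-g/2) comes from the normalisation of [zeta],
    the other from the slack in its recursion. [m.+2] is the largest 1 + |x| over the range |x| <= m
    + 1 where [height] is bounded. *)
Definition stay_rate (c : R) (m : nat) : R :=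
  c * (1 - expR (- (g / 2))) ^+ 2 * expR (- (C + q * ln m.+2%:R)).

(** Superharmonicity at rate lam reduces to rho(x) zeta(x-1)/(1 - zeta(x-1)) <= (1 - S) zeta(x)
    together with lam <= w(x) S zeta(x); a small multiple of [height] satisfies both. The prefactor
    bounds h(0), a product of m + 1 factors 1/(1 - zeta), each at most exp(g/2). *)
Lemma stay_le (c : R) (m N : nat) : 0 < c -> (forall x, c <= w x <= 1 - c) ->
  walk_prob w N 0 (all (fun y => `|y| <= m)%N) <=
  expR (g / 2 * m.+1%:R - stay_rate c m * N%:R).
Proof.
move=> c0 wc; rewrite /stay_rate; set S := 1 - expR _; set B := expR (- (C + _)).
set lam := _ * B.
have S0 : 0 < S by rewrite subr_gt0 expR_lt1 oppr_lt0 divr_gt0.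
have S1 : 1 - S = expR (- (g / 2)) by rewrite /S; lra.
have S1_gt0 : 0 < 1 - S by rewrite S1 expR_gt0.
have B0 : 0 < B by exact: expR_gt0.
(* h, defined below by h(x+1) = h(x) (1 - zeta x), is the superharmonic test
   function; (1 - S) ^ 2 = exp(- g) absorbs the quadratic terms in zeta. *)
pose zeta x := S * B * height x.
have zeta_ge x : S * B <= zeta x.
  by rewrite /zeta ler_peMr ?height_ge1// ltW// mulr_gt0.
have zeta0 x : 0 < zeta x by apply: lt_le_trans (zeta_ge x); rewrite mulr_gt0.
have zetaS x : (`|x| <= m.+1)%N -> zeta x <= S.
  move=> xm; rewrite /zeta -mulrA ler_piMr ?(ltW S0)//.
  rewrite -[leRHS]expR0 -[0](subrr (C + q * ln m.+2%:R)) addrC expRD ler_wpM2l ?(ltW B0)//.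
  apply: (le_trans (height_le x)); rewrite ler_expR lerD2l ler_wpM2l//.
  by rewrite -[m.+2%:R]nat1r ln_mono.
(* The cut-off avoids sites where [zeta] may exceed 1. The range goes up to [m.+1] because
   superharmonicity at [x] involves [zeta (x - 1)]. *)
pose f x := if (`|x| <= m.+1)%N then - ln (1 - zeta x) else 0.
have f_ge0 x : 0 <= f x.
  rewrite /f; case: ifP => // /zetaS zS; rewrite oppr_ge0 ln_le0//.
  by rewrite lerBlDr lerDl ltW.
have f_le x : f x <= g / 2.
  rewrite /f; case: ifP => [/zetaS zS|_]; last by rewrite divr_ge0// ltW.
  rewrite lerNl -[leLHS]expRK -S1 ler_ln ?posrE// ?lerD2l ?lerN2//.
  by apply: lt_le_trans S1_gt0 _; rewrite lerD2l lerN2.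
have [F FS] := antidifference f.
pose h x := expR (F (m%:Z + 1) - F x).
have F_mono x (k : nat) : F x <= F (x + k%:Z).
  elim: k => [|k IH]; first by rewrite addr0.
  by rewrite -[k.+1]addn1 PoszD addrA FS (le_trans IH)// lerDl.
have F_lip (k : nat) : F k%:Z <= F 0 + g / 2 * k%:R.
  elim: k => [|k IH]; first by rewrite mulr0 addr0.
  by rewrite -[k.+1]addn1 PoszD FS natrD mulrDr mulr1 addrA lerD.
have hS x : (`|x| <= m.+1)%N -> h (x + 1) = h x * (1 - zeta x).
  move=> xm; rewrite /h -[1 - zeta x]lnK; last first.
    by rewrite posrE; apply: lt_le_trans S1_gt0 _; rewrite lerD2l lerN2 zetaS.
  by rewrite -expRD (FS x) /f xm; congr expR; ring.
have allE : all (fun y : int => `|y| <= m)%N =1 all (fun y : int => (`|y| <= m%:Z)%R).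
  by apply: eq_all => y; lia.
rewrite (eq_walk_prob _ _ _ _ (all (fun y : int => (`|y| <= m%:Z)%R))); last first.
  by move=> s; rewrite allE.
have S_lt1 : S <= 1 by rewrite /S; have := expR_gt0 (- (g / 2)); lra.
have c1 : c <= 1 by have /andP[] := wc 0; have := env_lt1 w 0; lra.
have SB1 : S * B <= S.
  exact: (le_trans (zeta_ge 0) (zetaS 0 (leq0n _))).
have lam1 : 0 <= 1 - lam.
  rewrite subr_ge0 /lam expr2 -!mulrA.
  have SSB : 0 <= S * (S * B) by rewrite !mulr_ge0// ltW.
  apply: (@le_trans _ _ (S * (S * B))); first by rewrite ler_piMl.
  by rewrite -[leRHS]mulr1 ler_pM ?(ltW S0)// ?(le_trans SB1)// mulr_ge0// ltW.
have stay := walk_stay_le w lam m%:Z h lam1 (fun x => expR_ge0 _).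
suff [H1 H2] : (forall x : int, (`|x| <= m%:Z)%R -> 1 <= h x) /\ (forall x : int, (`|x| <= m%:Z)%R ->
    w x * h (x + 1) + (1 - w x) * h (x - 1) <= (1 - lam) * h x).
  apply: le_trans (stay H1 H2 N 0) _.
  rewrite [X in _ <= expR X]addrC expRD; apply: ler_pM; rewrite ?exprn_ge0 ?expR_ge0//.
    rewrite -[- (lam * _)]mulNr expRM_natr; apply: lerXn2r; rewrite ?nnegrE ?expR_ge0//.
    by have := expR_ge1Dx (- lam); lra.
  by rewrite ler_expR lerBlDl; have := F_lip m.+1; rewrite -[m.+1]addn1 PoszD.
split.
- move=> x xm; rewrite -[leLHS]expR0 ler_expR subr_ge0.
  have [k ->] : exists k : nat, m%:Z + 1 = x + k%:Z.
    by exists (absz (m%:Z + 1 - x)%R); move: xm; clear; lia.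
  exact: F_mono.
- move=> x xm.
  have x1 : (`|x| <= m.+1)%N by move: xm; clear; lia.
  have x2 : (`|x - 1| <= m.+1)%N by move: xm; clear; lia.
  rewrite (hS x x1); have := hS (x - 1) x2; rewrite subrK => hE.
  have z1 : 0 < 1 - zeta (x - 1).
    by apply: lt_le_trans S1_gt0 _; rewrite lerD2l lerN2 zetaS.
  have -> : h (x - 1) = h x / (1 - zeta (x - 1)).
    by rewrite hE mulfK// lt0r_neq0.
  have hx : 0 <= h x by exact: expR_ge0.
  rewrite [leLHS](_ : _ = (w x * (1 - zeta x) + (1 - w x) / (1 - zeta (x - 1))) * h x); last first.
    by field; exact: lt0r_neq0.
  apply: ler_wpM2r => //.
  have w0 := env_gt0 w x.
  rewrite [X in _ + X <= _](_ : _ = (1 - w x) +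
     w x * (rho w x * (zeta (x - 1) / (1 - zeta (x - 1))))); last first.
    rewrite /rho; have := lt0r_neq0 w0; have := lt0r_neq0 z1 => *.
    by field; apply/andP.
  (* [height_step] yields rho(x) zeta(x-1) <= exp(-g) zeta(x) = (1 - S)^2 zeta(x); dividing by 1 -
     zeta(x-1) >= 1 - S uses up one of the two factors. *)
  have key : rho w x * (zeta (x - 1) / (1 - zeta (x - 1))) <= (1 - S) * zeta x.
    apply: (@le_trans _ _ (rho w x * (zeta (x - 1) / (1 - S)))).
      rewrite ler_wpM2l ?(ltW (rho_gt0 w x))//; apply: ler_wpM2l; first exact: ltW.
      by rewrite lef_pV2 ?posrE// lerD2l lerN2 zetaS.
    rewrite mulrA ler_pdivrMr//.
    rewrite [leRHS](_ : _ = expR (- g) * zeta x); last first.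
      by rewrite mulrAC S1 -expRD; congr (expR _ * _); lra.
    rewrite expRN mulrC ler_pdivlMl ?expR_gt0//.
    rewrite /zeta [leLHS](_ : _ = S * B * (rho w x * expR g * height (x - 1))); last by ring.
    by rewrite ler_wpM2l ?height_step// mulr_ge0// ltW.
  have k2 := ler_wpM2l (ltW w0) key.
  have k3 : lam <= w x * (S * zeta x).
    have /andP[cw _] := wc x.
    rewrite /lam expr2 -!mulrA; apply: ler_pM => //; [exact: ltW| |].
      by rewrite !mulr_ge0// ltW.
    by rewrite ler_wpM2l ?(ltW S0).
  move: k2 k3; lra.
Qed.

End displacement.

(** * Law of finite trajectories *)

Section markov_path_law.
Context {R : realType} {d : measure_display} {S : measurableType d}.
Variables (Q : probability S R) (Z : countType) (X : nat -> S -> Z).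
Variables (supp : Z -> seq Z) (k : Z -> Z -> R).
Hypothesis mX : forall n z, measurable (X n @^-1` [set z]).
Hypothesis supp_uniq : forall z, uniq (supp z).
Hypothesis k_sum1 : forall z, \sum_(y <- supp z) k z y = 1.
Hypothesis stepX : forall (n : nat) (a : nat -> Z) (y : Z),
  Q [set s | (forall i, (i <= n)%N -> X i s = a i) /\ X n.+1 s = y] =
  ((k (a n) y)%:E * Q [set s | forall i, (i <= n)%N -> X i s = a i])%E.

Let prefix (n : nat) (a : nat -> Z) : set S :=
  [set s | forall i, (i <= n)%N -> X i s = a i].

Let trace (n N : nat) (s : S) : seq Z := [seq X i s | i <- iota n N].

Let measurable_prefix n a : measurable (prefix n a).
Proof.
have -> : prefix n a = \bigcap_(i in [set i | (i <= n)%N]) (X i @^-1` [set a i]).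
  by apply/seteqP; split.
by apply: bigcap_measurableType => i _; exact: mX.
Qed.

Let measurable_trace n N (A : pred (seq Z)) : measurable [set s | A (trace n N s)].
Proof.
elim: N n A => [|N IH] n A.
  rewrite /trace/=; case: (A [::]).
    by rewrite (_ : [set _ | _] = setT)//; apply/seteqP; split.
  by rewrite (_ : [set _ | _] = set0)//; apply/seteqP; split.
rewrite (_ : [set _ | _] = \bigcup_z (X n @^-1` [set z] `&`
    [set s | A (z :: trace n.+1 N s)])).
  apply: countable_bigcupT_measurable => // z; apply: measurableI => //.
  exact: (IH _ (fun s => A (z :: s))).
apply/seteqP; split => s /=; first by exists (X n s).
by move=> [z _ [/= <-]].
Qed.

Let split_values (E : set S) (Y : S -> Z) (l : seq Z) : uniq l -> measurable E ->
  (forall z, measurable (Y @^-1` [set z])) ->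
  (Q E = \sum_(y <- l) Q (E `&` Y @^-1` [set y]) +
         Q (E `&` [set s | Y s \notin l]))%E.
Proof.
move=> + mE mY; elim: l => [|y l IH] /=.
  by move=> _; rewrite big_nil add0e (_ : E `&` _ = E)//; apply/seteqP; split => [s []|].
move=> /andP[yl ul]; rewrite (IH ul) big_cons -addeA addeCA; congr (_ + _)%E.
have mN (r : seq Z) : measurable [set s | Y s \notin r].
  elim: r => [|z r IHr].
    by rewrite (_ : [set _ | _] = setT)//; apply/seteqP; split.
  rewrite (_ : [set _ | _] = ~` (Y @^-1` [set z]) `&` [set s | Y s \notin r]).
    by apply: measurableI => //; exact/measurableC/mY.
  apply/seteqP; split => s /=; rewrite inE negb_or.
    by move=> /andP[/eqP].
  by move=> [/eqP yz yr]; apply/andP.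
rewrite (measureDI _ (measurableI _ _ mE (mN l)) (mY y)) addeC; congr (_ + _)%E.
  congr (Q _); apply/seteqP; split => s /=.
    by move=> [[Es sl] /eqP sy]; split => //; rewrite inE negb_or sy.
  by rewrite inE negb_or => -[Es /andP[/eqP sy sl]].
congr (Q _); apply/seteqP; split => s /=; first by move=> [[Es _] sy].
by move=> [Es sy]; split => //; split => //; rewrite sy.
Qed.

Let prefix_trace n N a (A : pred (seq Z)) :
  Q (prefix n a `&` [set s | A (trace n N.+1 s)]) =
  ((path_prob supp k N (a n) A)%:E * Q (prefix n a))%E.
Proof.
elim: N n a A => [|N IH] n a A.
  rewrite /trace/=; case: (boolP (A [:: a n])) => [An|nAn].
    rewrite mul1e; congr (Q _); apply/seteqP; split => s /=; first by case.
    by move=> sa; split => //; rewrite sa.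
  rewrite mul0e (_ : _ `&` _ = set0) ?measure0//.
  by apply/seteqP; split => s //= [sa]; rewrite sa// (negbTE nAn).
pose F := prefix n a `&` [set s | A (trace n N.+2 s)].
have mF : measurable F by exact: measurableI.
have E y : Q (F `&` X n.+1 @^-1` [set y]) =
    ((k (a n) y * path_prob supp k N y (fun s => A (a n :: s)))%:E * Q (prefix n a))%E.
  pose a' i := if i == n.+1 then y else a i.
  have a'n i : (i <= n)%N -> a' i = a i.
    by rewrite /a'; case: eqP => // ->; rewrite ltnn.
  have pE : prefix n.+1 a' = [set s | (forall i, (i <= n)%N -> X i s = a i) /\ X n.+1 s = y].
    apply/seteqP; split => s /=.
      move=> sa; split => [i ni|]; first by rewrite sa ?a'n// leqW.
      by rewrite sa// /a' eqxx.
    move=> [sa sy] i; rewrite leq_eqVlt => /orP[/eqP->|ni].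
      by rewrite /a' eqxx.
    by rewrite a'n// sa.
  rewrite (_ : _ `&` _ = prefix n.+1 a' `&` [set s | (fun t => A (a n :: t)) (trace n.+1 N.+1 s)]).
    rewrite [LHS](IH n.+1 a' (fun t => A (a n :: t))) {1}/a' eqxx pE stepX muleA; congr (_ * _)%E.
    by rewrite -EFinM mulrC.
  rewrite pE; apply/seteqP; split => s /=.
    by move=> [[sa sA] sy]; split => //; rewrite -(sa n).
  by move=> [[sa sy] sA]; split => //; split => //; move: sA; rewrite -(sa n).
have pfin : Q (prefix n a) \is a fin_num by exact: fin_num_measure.
pose p := fine (Q (prefix n a)); have pE : Q (prefix n a) = p%:E by rewrite fineK.
(* The transitions listed in [supp] already carry the full mass of the prefix, so a step outside
   [supp] has probability 0. *)
have out0 : Q (prefix n a `&` [set s | X n.+1 s \notin supp (a n)]) = 0%E.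
  have := split_values (prefix n a) (X n.+1) _ (supp_uniq (a n)) (measurable_prefix _ _) (mX _).
  rewrite (eq_bigr (fun y => (k (a n) y * p)%:E)); last first.
    by move=> y _; rewrite EFinM -pE -stepX; congr (Q _); apply/seteqP; split.
  rewrite sumEFin -mulr_suml k_sum1 mul1r pE.
  have : Q (prefix n a `&` [set s | X n.+1 s \notin supp (a n)]) \is a fin_num.
    apply: fin_num_measure; apply: measurableI => //.
    exact: (measurable_trace n.+1 1 (fun t => head (a n) t \notin supp (a n))).
  move=> /fineK <-; rewrite -EFinD => -[pp]; congr EFin.
  by move: pp => /eqP; rewrite -[X in X == _]addr0 (inj_eq (addrI p)) => /eqP.
rewrite -/F (split_values F (X n.+1) _ (supp_uniq (a n)) mF)//.
rewrite [X in (_ + X)%E](_ : _ = 0%E) ?adde0; last first.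
  apply: (subset_measure0 _ _ _ out0).
  - apply: measurableI => //.
    exact: (measurable_trace n.+1 1 (fun t => head (a n) t \notin supp (a n))).
  - apply: measurableI => //.
    exact: (measurable_trace n.+1 1 (fun t => head (a n) t \notin supp (a n))).
  - by move=> s [[sa _] sl].
rewrite (eq_bigr _ (fun y _ => E y)) pE.
under eq_bigr do rewrite -EFinM.
by rewrite sumEFin -mulr_suml.
Qed.

(** The passage from a process on a probability space to finite sums. It is used for the walk under
    the quenched law and for the letters of the environment under P. *)
Lemma path_law (z0 : Z) N (A : pred (seq Z)) : Q [set s | X 0%N s = z0] = 1%E ->
  Q [set s | A [seq X i s | i <- iota 0 N.+1]] = (path_prob supp k N z0 A)%:E.
Proof.
move=> X0; have mA := measurable_trace 0 N.+1 A.
have pre : prefix 0 (fun=> z0) = [set s | X 0%N s = z0].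
  apply/seteqP; split => s /=; first exact.
  by move=> sz i; rewrite leqn0 => /eqP ->.
have := prefix_trace 0 N (fun=> z0) A; rewrite pre X0 mule1 => <-.
rewrite (measureDI _ mA (mX 0%N z0)) [X in (X + _)%E](_ : _ = 0%E) ?add0e.
  by rewrite setIC.
have X0C : Q (~` [set s | X 0%N s = z0]) = 0%E.
  by rewrite probability_setC ?X0 ?subee//; exact: mX.
apply: (subset_measure0 _ _ _ X0C).
- by apply: measurableD => //; exact: mX.
- by apply: measurableC; exact: mX.
- by move=> s [].
Qed.

Lemma measurable_path N (A : pred (seq Z)) :
  measurable [set s | A [seq X i s | i <- iota 0 N]].
Proof. exact: measurable_trace. Qed.

End markov_path_law.

(** * Quenched asymptotics *)

Section power_asymptotics.
Context {R : realType}.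
Implicit Types a b c A M : R.

Lemma near_ge_powR a M : 0 < a -> \forall n \near \oo, M <= n%:R `^ a.
Proof.
move=> a0; pose M' := Num.max M 0.
have M'0 : 0 <= M' by rewrite le_max lexx orbT.
exists (Num.truncn (M' `^ a^-1)).+1 => // n /= Nn.
apply: (@le_trans _ _ M'); first by rewrite le_max lexx.
have -> : M' = (M' `^ a^-1) `^ a by rewrite -powRrM mulVf ?powRr1// lt0r_neq0.
apply: ge0_ler_powR; rewrite ?nnegrE ?powR_ge0//; first exact: ltW.
apply: ltW; apply: lt_le_trans (truncnS_gt _) _.
by rewrite ler_nat.
Qed.

Lemma near_powR_le a b A c : a < b -> 0 < c ->
  \forall n \near \oo, A * n%:R `^ a <= c * n%:R `^ b.
Proof.
move=> ab c0; have := near_ge_powR (b - a) (A / c).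
rewrite subr_gt0 => /(_ ab) H; near=> n.
have n0 : (0 < n)%N by near: n; exact: nbhs_infty_gt.
have -> : n%:R `^ b = n%:R `^ (b - a) * n%:R `^ a :> R.
  by rewrite -powRD ?subrK// pnatr_eq0 -lt0n n0 implybT.
rewrite mulrA; apply: ler_wpM2r; first exact: powR_ge0.
by rewrite mulrC -ler_pdivrMr//; near: n.
Unshelve. all: by end_near. Qed.

Lemma near_exp_powR_le a b A c (e : R) : 0 < a -> a < b -> 0 < c -> 0 < e ->
  \forall n \near \oo, expR (A * n%:R `^ a - c * n%:R `^ b) <= e.
Proof.
move=> a0 ab c0 e0; have H1 := near_powR_le a b (A + 1) c ab c0.
have H2 := near_ge_powR a e^-1 a0; near=> n.
apply: (@le_trans _ _ (expR (- n%:R `^ a))).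
  rewrite ler_expR; have : (A + 1) * n%:R `^ a <= c * n%:R `^ b by near: n.
  by rewrite mulrDl mul1r; lra.
rewrite expRN -[leRHS]invrK lef_pV2 ?posrE ?expR_gt0 ?invr_gt0//.
apply: (@le_trans _ _ (n%:R `^ a)); first by near: n.
by have := expR_ge1Dx (n%:R `^ a : R); lra.
Unshelve. all: by end_near. Qed.

(** Logarithmic terms are absorbed into a power of n with small exponent, so that the later
    comparisons involve powers only. *)
Lemma ln_le_powR a (x : R) : 0 < a -> 0 < x -> ln x <= x `^ a / a.
Proof.
move=> a0 x0; rewrite ler_pdivlMr// mulrC -ln_powR ltW// ln_sublinear//.
exact: powR_gt0.
Qed.

Lemma powR_ge1 a (n : nat) : 0 <= a -> (0 < n)%N -> 1 <= n%:R `^ a :> R.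
Proof.
move=> a0 n0; have {1}-> : 1 = 1 `^ a :> R by rewrite powR1.
by apply: ge0_ler_powR; rewrite ?nnegrE ?ler1n.
Qed.

Lemma powR_le_exp a b (n : nat) : a <= b -> (0 < n)%N -> n%:R `^ a <= n%:R `^ b :> R.
Proof. by move=> ab n0; apply: ler_powR => //; rewrite ler1n. Qed.

Lemma cvg0_of_exp_powR (u : nat -> R) a b A c : 0 < a -> a < b -> 0 < c ->
  (\forall n \near \oo, 0 <= u n <= expR (A * n%:R `^ a - c * n%:R `^ b)) ->
  u @ \oo --> (0 : R).
Proof.
move=> a0 ab c0 H; apply/cvgrPdist_le => e e0.
have H2 := near_exp_powR_le a b A c e a0 ab c0 e0; near=> n.
have /andP[u0 u1] : 0 <= u n <= expR (A * n%:R `^ a - c * n%:R `^ b) by near: n.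
rewrite sub0r normrN ger0_norm//; apply: (le_trans u1); near: n; exact: H2.
Unshelve. all: by end_near. Qed.

End power_asymptotics.

Section power_asymptotics_nat.
Context {R : realType}.
Implicit Types a : R.

Lemma ln_nat_le a (k j n : nat) : 0 < a -> (0 < k)%N -> (k <= j * n)%N ->
  ln k%:R <= j%:R `^ a / a * n%:R `^ a :> R.
Proof.
move=> a0 k0 kjn; apply: le_trans (ln_le_powR a k%:R a0 _) _.
  by rewrite ltr0n.
rewrite mulrAC -powRM ?ler0n// ler_wpM2r ?invr_ge0 ?(ltW a0)//.
by apply: ge0_ler_powR; rewrite ?nnegrE ?mulr_ge0 ?ler0n ?(ltW a0)// -natrM ler_nat.
Qed.

Lemma near_truncn_powR a (P : nat -> Prop) : 0 < a ->
  (\forall m \near \oo, P m) -> \forall n \near \oo, P (Num.truncn (n%:R `^ a : R)).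
Proof.
move=> a0 [N _ H]; have HN := near_ge_powR a N%:R a0; near=> n.
apply: H; rewrite /= truncn_ge_nat ?powR_ge0//; near: n; exact: HN.
Unshelve. all: by end_near. Qed.

Lemma truncn_powR_bounds a (n : nat) : 0 <= a -> (0 < n)%N ->
  let m := Num.truncn (n%:R `^ a : R) in
  [/\ (0 < m)%N, m%:R <= n%:R `^ a & n%:R `^ a < m.+1%:R].
Proof.
move=> a0 n0 m; have p1 := powR_ge1 a n a0 n0; split.
- by rewrite /m truncn_gt0.
- by rewrite /m truncn_le powR_ge0.
- exact: truncnS_gt.
Qed.

End power_asymptotics_nat.

(** * Balancing the exponents in a fixed environment *)

Section quenched_asymptotics.
Context {R : realType}.
Variables (w : environment R) (c kappa : R).
Hypothesis c_gt0 : 0 < c.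
Hypothesis w_ell : forall x, c <= w x <= 1 - c.
Hypothesis kappa_gt0 : 0 < kappa.
Hypothesis drift_w : forall q, kappa^-1 < q -> drift_bound w q.
Hypothesis wells_w : forall q, 0 < q -> q < kappa^-1 -> has_wells w q.

Let alpha := kappa / (kappa + 1).

Let k1_gt0 : 0 < kappa + 1. Proof. by rewrite addr_gt0. Qed.

Let alpha_gt0 : 0 < alpha. Proof. by rewrite divr_gt0. Qed.

Let alpha_lt1 : alpha < 1.
Proof. by rewrite ltr_pdivrMr// mul1r ltrDl. Qed.

Let alphaE : alpha * (1 + kappa^-1) = 1.
Proof.
rewrite /alpha; have := lt0r_neq0 kappa_gt0; have := lt0r_neq0 k1_gt0 => *.
by field; apply/andP.
Qed.

(** [has_wells] gives the right wall. For the left one, V falls by g m up to logarithmic terms over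
    the m sites before b, far more than q ln m. *)
Lemma near_well (q : R) : 0 < q -> q < kappa^-1 ->
  \forall m \near \oo, exists b l : nat, [/\ (b + l <= m)%N,
    expR (- log_sum_up w (b%:Z + 1) l) <= m%:R `^ (- q) &
    expR (log_sum_down w (b%:Z - 1) m) <= m%:R `^ (- q)].
Proof.
move=> q0 qk; have [m0 wells] := wells_w q q0 qk.
pose q1 := kappa^-1 + 1.
have [|C [g [g0 dr]]] := drift_w q1; first by rewrite ltrDl.
have q1_gt0 : 0 < q1 by rewrite addr_gt0// invr_gt0.
have h2 : (0 : R) < 2^-1 by rewrite invr_gt0.
have h21 : (2^-1 : R) < 1 by lra.
have [K KE] : exists K : R, K = 2%:R `^ 2^-1 / 2^-1 by eexists.
have H1 := near_powR_le 2^-1 1 (`|C| + (q1 + q) * K) g h21 g0.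
near=> m.
have m1 : (0 < m)%N by near: m; exact: nbhs_infty_gt.
have m_gt0 : (0 : R) < m%:R by rewrite ltr0n.
have m0m : (m0 <= m)%N by near: m; exact: nbhs_infty_ge.
have [b [l [blm up]]] := wells m m0m; exists b, l.
have eq1 : m%:R `^ (- q) = expR (- (q * ln m%:R)) :> R.
  by rewrite /powR gt_eqF// mulNr.
split => //; rewrite eq1 ler_expR; first by rewrite lerN2.
apply: (le_trans (dr _ _)).
have bm : ((1 + `|(b%:Z - 1)%R|)%N <= 2 * m)%N by move: blm m1; clear; lia.
have H : (`|C| + (q1 + q) * K) * m%:R `^ 2^-1 <= g * m%:R `^ 1 by near: m.
have pm : 1 <= m%:R `^ 2^-1 :> R by apply: powR_ge1 => //; exact: ltW.
have L1 := ln_nat_le 2^-1 (1 + `|(b%:Z - 1)%R|) 2 m h2 isT bm.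
have mm : (m <= 2 * m)%N by rewrite leq_pmull.
have L2 := ln_nat_le 2^-1 m 2 m h2 m1 mm.
rewrite natrD in L1.
have C1 : C <= `|C| * m%:R `^ 2^-1.
  by apply: (le_trans (ler_norm C)); rewrite ler_peMr.
have L1' := ler_wpM2l (ltW q1_gt0) L1; have L2' := ler_wpM2l (ltW q0) L2.
rewrite powRr1 ?ler0n// in H.
rewrite -KE in L1' L2'; move: H L1' L2' C1; clear.
move: (m%:R `^ 2^-1 : R) => X; rewrite !mulrDl -!mulrA.
move: (K * X) (ln m%:R) (ln _) => KX lm lb; lra.
Unshelve. all: by end_near. Qed.

Lemma near_return_ge (a : R) : alpha < a -> a < 1 ->
  exists A : R, \forall n \near \oo,
    expR (- (A * n%:R `^ a)) <= walk_prob w (2 * n) 0 ends_at0.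
Proof.
move=> aa a1; have a0 : 0 < a by apply: lt_trans aa.
have k_inv : 0 < kappa^-1 by rewrite invr_gt0.
have r0 : 0 < (1 - a) / a by rewrite divr_gt0// subr_gt0.
have rk : (1 - a) / a < kappa^-1.
  rewrite ltr_pdivrMr//.
  have : alpha * (1 + kappa^-1) < a * (1 + kappa^-1) by rewrite ltr_pM2r// addr_gt0.
  by rewrite alphaE; lra.
pose q := ((1 - a) / a + kappa^-1) / 2.
have q0 : 0 < q by rewrite /q divr_gt0// addr_gt0.
have qk : q < kappa^-1 by rewrite /q; lra.
have qr : (1 - a) / a < q by rewrite /q; lra.
have aq : 1 - a * q <= a.
  by move: qr; rewrite ltr_pdivrMr// mulrC => ?; lra.
have c1 : c < 1 by have /andP[? ?] := w_ell 0; have := env_lt1 w 0; have := env_gt0 w 0; lra.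
have [L LE] : exists L, L = - ln c by exists (- ln c).
have L0 : 0 < L by rewrite LE oppr_gt0 ln_lt0// c_gt0.
(* From m + 1 <= 2 n^a, c^(2(m+1)) >= exp(-4 L n^a). From del <= 1/2, (1 - del)^(2n) >= exp(-4 n
   del), and n del <= 2^q n^a because n^a <= 2m. *)
exists (4 * L + 4 * 2 `^ q).
have N1 := near_truncn_powR a _ a0 (near_well q q0 qk).
have N2 := near_powR_le a 1 2 1 a1 ltr01.
have N3 := near_truncn_powR a _ a0 (near_ge_powR q 2 q0).
near=> n; pose m := Num.truncn (n%:R `^ a : R).
have n0 : (0 < n)%N by near: n; exact: nbhs_infty_gt.
have [m1 mn nm] := truncn_powR_bounds a n (ltW a0) n0; rewrite -/m in m1 mn nm.
have [b [l [blm wup wdown]]] : exists b l : nat, [/\ (b + l <= m)%N,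
    expR (- log_sum_up w (b%:Z + 1) l) <= m%:R `^ (- q) &
    expR (log_sum_down w (b%:Z - 1) m) <= m%:R `^ (- q)] by rewrite /m; near: n.
have m2 : 2 <= m%:R `^ q :> R by rewrite /m; near: n.
have m1R : (1 : R) <= m%:R by rewrite ler1n.
have mnn : (m.+1 <= n)%N.
  have H : 2 * n%:R `^ a <= 1 * n%:R `^ 1 :> R by near: n.
  rewrite -(ler_nat R) -natr1; move: H; rewrite mul1r powRr1 ?ler0n//; lra.
pose del : R := m%:R `^ (- q).
have mq0 : 0 < m%:R `^ q :> R by lra.
have dm : del * m%:R `^ q = 1 by rewrite /del powRN mulVf// lt0r_neq0.
have del0 : 0 <= del by exact: powR_ge0.
have del2 : del <= 2^-1 by rewrite /del powRN lef_pV2 ?posrE.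
have del01 : 0 <= del <= 1 by rewrite del0/=; lra.
apply: le_trans (return_prob_ge w c del m n b l c_gt0 w_ell del01 blm mnn wup wdown).
rewrite mulrDl opprD expRD; apply: ler_pM; rewrite ?expR_ge0//.
- rewrite -(lnK (_ : c \in Num.pos)) ?posrE// -expRM_natl ler_expR.
  rewrite -[ln c]opprK -LE mulrN lerN2 natrM -natr1.
  rewrite [leRHS](_ : _ = 4 * n%:R `^ a * L); last by ring.
  by rewrite ler_wpM2r ?(ltW L0)//; lra.
- have d2 : expR (- (2 * del)) <= 1 - del.
    rewrite expRN -[leLHS]mul1r ler_pdivrMr ?expR_gt0//.
    have e2 := expR_ge1Dx (2 * del).
    have H1 : (1 - del) * (1 + 2 * del) <= (1 - del) * expR (2 * del).
      by rewrite ler_wpM2l//; lra.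
    apply: le_trans H1.
    rewrite (_ : (1 - del) * (1 + 2 * del) = 1 + del * (1 - 2 * del)); last by ring.
    by rewrite lerDl mulr_ge0//; lra.
  apply: (@le_trans _ _ (expR (- (2 * del)) ^+ (2 * n))); last first.
    by apply: lerXn2r => //; rewrite nnegrE ?expR_ge0//; lra.
  rewrite -expRM_natl ler_expR mulrN lerN2 natrM.
  rewrite [leLHS](_ : _ = 4 * (n%:R * del)); last by ring.
  rewrite -mulrA ler_wpM2l//.
  have nE : n%:R = n%:R `^ (1 - a * q) * n%:R `^ (a * q) :> R.
    by rewrite -powRD ?subrK ?powRr1 ?ler0n// pnatr_eq0 -lt0n n0 implybT.
  have s1 : n%:R `^ (a * q) <= 2 `^ q * m%:R `^ q :> R.
    rewrite powRrM -powRM ?ler0n//; apply: ge0_ler_powR.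
    - exact: ltW.
    - by rewrite nnegrE powR_ge0.
    - by rewrite nnegrE mulr_ge0 ?ler0n.
    - by move: nm; rewrite -natr1; lra.
  have s2 : n%:R `^ (1 - a * q) <= n%:R `^ a :> R by exact: powR_le_exp.
  apply: (@le_trans _ _ (n%:R `^ a * (2 `^ q * m%:R `^ q) * del)).
    by apply: ler_wpM2r => //; rewrite [leLHS]nE; apply: ler_pM; rewrite ?powR_ge0.
  rewrite [leLHS](_ : _ = 2 `^ q * n%:R `^ a * (del * m%:R `^ q)); last by ring.
  by rewrite dm mulr1.
Unshelve. all: by end_near. Qed.

Definition reaches (y : R) : pred (seq int) :=
  fun s => y <= (\max_(x <- s) `|x|)%N%:R.

Lemma reaches_le (y z : R) s : y <= z -> reaches z s -> reaches y s.
Proof. by move=> yz; exact: le_trans. Qed.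

(** Common end of both regimes: the error terms and the denominator are measured with the same
    exponent a > alpha, and any decay of a larger order n^b wins. *)
Let near_ratio (a b A K : R) (f : nat -> R) : alpha < a -> a < b -> a < 1 -> 0 < K ->
  (forall n, 0 <= f n) ->
  (\forall n \near \oo, f n <= expR (A * n%:R `^ a - K * n%:R `^ b)) ->
  (fun n => f n / walk_prob w (2 * n) 0 ends_at0) @ \oo --> (0 : R).
Proof.
move=> aa ab a1 K0 f0 fle; have [A' DA] := near_return_ge a aa a1.
have a0 : 0 < a by apply: lt_trans aa.
apply: (cvg0_of_exp_powR _ a b (A + A') K a0 ab K0); near=> n.
have D1 : expR (- (A' * n%:R `^ a)) <= walk_prob w (2 * n) 0 ends_at0 by near: n.
have D0 : 0 < walk_prob w (2 * n) 0 ends_at0 by apply: lt_le_trans D1; exact: expR_gt0.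
apply/andP; split; first by rewrite divr_ge0// ltW.
rewrite ler_pdivrMr//.
apply: (@le_trans _ _ (expR (A * n%:R `^ a - K * n%:R `^ b))); first by near: n.
rewrite [leLHS](_ : _ = expR ((A + A') * n%:R `^ a - K * n%:R `^ b) * expR (- (A' * n%:R `^ a))).
  by rewrite ler_wpM2l ?expR_ge0.
by rewrite -expRD; congr expR; ring.
Unshelve. all: by end_near. Qed.

(** The exponent a is taken between alpha and beta. Here q enters only through a logarithm, so any q
    > 1/kappa serves; beta < 1 keeps the level within the range allowed by [displaced_return_le]. *)
Lemma far_ratio_cvg0 (beta : R) : alpha < beta -> beta < 1 ->
  (fun n => walk_prob w (2 * n) 0
      (fun s => reaches (n%:R `^ beta) s && ends_at0 s) /
    walk_prob w (2 * n) 0 ends_at0) @ \oo --> (0 : R).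
Proof.
move=> ab b1; have b0 : 0 < beta by apply: lt_trans ab.
pose a := (alpha + beta) / 2.
have aa : alpha < a by rewrite /a; lra.
have ab' : a < beta by rewrite /a; lra.
have a0 : 0 < a by apply: lt_trans aa.
have a1 : a < 1 by apply: lt_trans b1.
pose q := kappa^-1 + 1.
have [|C [g [g0 dr]]] := drift_w q; first by rewrite ltrDl.
have q0 : 0 <= q by rewrite addr_ge0 ?invr_ge0 ?(ltW kappa_gt0).
have [K KE] : exists K : R, K = 3%:R `^ a / a by eexists.
apply: (near_ratio a beta (ln 2 + (1 + q) * K + `|C| + g) g) => //.
  by move=> n; exact: walk_prob_ge0.
near=> n.
have n0 : (0 < n)%N by near: n; exact: nbhs_infty_gt.
pose m := Num.truncn (n%:R `^ beta : R).
have [m1 mn nm] := truncn_powR_bounds beta n (ltW b0) n0; rewrite -/m in m1 mn nm.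
have mnn : (m <= (2 * n).+1)%N.
  have : (m <= n)%N.
    rewrite -(ler_nat R); apply: (le_trans mn).
    by rewrite -[leRHS]powRr1 ?ler0n//; apply: powR_le_exp => //; exact: ltW.
  by clear; lia.
apply: (@le_trans _ _ (walk_prob w (2 * n) 0
    (fun s => has (fun y => m <= `|y|)%N s && ends_at0 s))).
  apply: walk_prob_le => s /andP[As ->]; rewrite andbT.
  apply: contraLR As; rewrite -all_predC /reaches -ltNge => /allP sm.
  apply: lt_le_trans (_ : _ < m%:R) mn.
  rewrite ltr_nat -(prednK m1) ltnS; apply/bigmax_leqP_seq => x xs _.
  by move: (sm x xs) m1; rewrite /= -ltnNge; clear; lia.
apply: le_trans (displaced_return_le w C g q g0 q0 dr n m m1 mnn) _.
have p2 : 0 < (2 * (2 * n).+1%:R : R) by rewrite mulr_gt0 ?ltr0n.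
rewrite -[2 * _]lnK ?posrE// -expRD ler_expR lnM ?posrE ?ltr0n//.
have L : ln (2 * n).+1%:R <= K * n%:R `^ a.
  by rewrite KE; apply: ln_nat_le => //; move: n0; clear; lia.
have L' : q * ln (1 + (2 * n)%:R) <= q * (K * n%:R `^ a).
  by rewrite nat1r ler_wpM2l.
have pa : 1 <= n%:R `^ a :> R by apply: powR_ge1 => //; exact: ltW.
have C1 : C <= `|C| * n%:R `^ a.
  by apply: (le_trans (ler_norm C)); rewrite ler_peMr.
have ln2 : 0 <= ln (2 : R) by rewrite ln_ge0// ler1n.
have ln2' : ln (2 : R) <= ln 2 * n%:R `^ a by rewrite ler_peMr.
have g1 : g <= g * n%:R `^ a by rewrite ler_peMr// ltW.
have gm : g * (n%:R `^ beta - 1) <= g * m%:R.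
  by rewrite ler_wpM2l ?(ltW g0)//; move: nm; rewrite -natr1; lra.
move: L L' C1 ln2' g1 gm; rewrite [(1 + q) * K]mulrDl mulrBr mulr1 !mulrDl mul1r -!mulrA; clear.
move: (K * _) (ln 2) (ln _) (ln (1 + _)) => *; lra.
Unshelve. all: by end_near. Qed.

(** As (1 - alpha)/alpha = 1/kappa, there is q with 1/kappa < q < (1 - alpha)/beta. Then alpha < 1 -
    beta q leaves room for a, and beta <= a absorbs the prefactor of [stay_le]. *)
Lemma near_ratio_cvg0 (beta : R) : 0 < beta -> beta < alpha ->
  (fun n => walk_prob w (2 * n) 0
      (fun s => ~~ reaches (n%:R `^ beta) s && ends_at0 s) /
    walk_prob w (2 * n) 0 ends_at0) @ \oo --> (0 : R).
Proof.
move=> b0 ba.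
have k_inv : 0 < kappa^-1 by rewrite invr_gt0.
have rk : kappa^-1 < (1 - alpha) / beta.
  rewrite ltr_pdivlMr//; have : kappa^-1 * beta < kappa^-1 * alpha by rewrite ltr_pM2l.
  by move: alphaE; lra.
pose q := (kappa^-1 + (1 - alpha) / beta) / 2.
have kq : kappa^-1 < q by rewrite /q; lra.
have q0 : 0 < q by apply: lt_trans kq.
have qb : alpha < 1 - beta * q.
  have : q < (1 - alpha) / beta by rewrite /q; lra.
  by rewrite ltr_pdivlMr// mulrC; lra.
have bq0 : 0 < beta * q by rewrite mulr_gt0.
pose a := (alpha + (1 - beta * q)) / 2.
have aa : alpha < a by rewrite /a; lra.
have aq : a < 1 - beta * q by rewrite /a; lra.
have a1 : a < 1 by lra.
have ba' : beta <= a by rewrite ltW// (lt_trans ba).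
have [C [g [g0 dr]]] := drift_w q kq.
have S0 : 0 < 1 - expR (- (g / 2)) by rewrite subr_gt0 expR_lt1 oppr_lt0 divr_gt0.
(* The 2 comes from the 2n steps, 3^(-q) from m + 2 <= 3 n^beta. *)
pose K := 2 * (c * (1 - expR (- (g / 2))) ^+ 2 * expR (- C)) * 3%:R `^ (- q).
have K0 : 0 < K by rewrite !mulr_gt0 ?exprn_gt0 ?expR_gt0 ?powR_gt0 ?ltr0n.
apply: (near_ratio a (1 - beta * q) g K) => //.
  by move=> n; exact: walk_prob_ge0.
near=> n.
have n0 : (0 < n)%N by near: n; exact: nbhs_infty_gt.
have nR : (0 : R) < n%:R by rewrite ltr0n.
pose m := Num.truncn (n%:R `^ beta : R).
have [m1 mn nm] := truncn_powR_bounds beta n (ltW b0) n0; rewrite -/m in m1 mn nm.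
apply: (@le_trans _ _ (walk_prob w (2 * n) 0 (all (fun y => `|y| <= m)%N))).
  apply: walk_prob_le => s /andP[As _]; apply/allP => x xs.
  have xM : (`|x| <= \max_(y <- (0 : int) :: s) `|y|)%N by exact: leq_bigmax_seq.
  apply: (leq_trans xM).
  rewrite truncn_ge_nat ?powR_ge0//; apply: ltW.
  by move: As; rewrite /reaches -ltNge.
apply: (le_trans (stay_le w C g q g0 (ltW q0) dr c m (2 * n) c_gt0 w_ell)).
rewrite ler_expR; apply: lerD.
  have : m%:R <= n%:R `^ a :> R by apply: (le_trans mn); exact: powR_le_exp.
  have : 1 <= n%:R `^ a :> R by apply: powR_ge1 => //; exact: (le_trans (ltW b0)).
  rewrite -natr1 => H1 H2; rewrite [leLHS](_ : _ = g * ((m%:R + 1) / 2)); last by ring.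
  by apply: ler_wpM2l; [exact: ltW|lra].
rewrite lerN2 /stay_rate opprD expRD /K.
have H3 : 3%:R `^ (- q) * n%:R `^ (- (beta * q)) <= expR (- (q * ln m.+2%:R)) :> R.
  have -> : expR (- (q * ln m.+2%:R)) = m.+2%:R `^ (- q) :> R.
    by rewrite /powR gt_eqF ?ltr0n// mulNr.
  rewrite (_ : n%:R `^ (- (beta * q)) = (n%:R `^ beta) `^ (- q)); last first.
    by rewrite -powRrM mulrN.
  rewrite -powRM ?ler0n ?powR_ge0// !powRN lef_pV2 ?posrE ?powR_gt0 ?mulr_gt0 ?ltr0n ?powR_gt0//.
  apply: ge0_ler_powR.
  - exact: ltW.
  - by rewrite nnegrE ler0n.
  - by rewrite nnegrE mulr_ge0 ?ler0n ?powR_ge0.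
  - by move: mn; have := powR_ge1 beta n (ltW b0) n0; rewrite -2!natr1; lra.
have nE : n%:R `^ (1 - beta * q) = n%:R * n%:R `^ (- (beta * q)) :> R.
  by rewrite powRD ?powRr1 ?ler0n// pnatr_eq0 -lt0n n0 implybT.
rewrite nE natrM; set z := c * _.
rewrite [leLHS](_ : _ = z * expR (- C) * (2 * n%:R) * (3%:R `^ (- q) * n%:R `^ (- (beta * q)))); last by ring.
rewrite [leRHS](_ : _ = z * expR (- C) * (2 * n%:R) * expR (- (q * ln m.+2%:R))); last by ring.
by apply: ler_wpM2l => //; rewrite !mulr_ge0 ?expR_ge0 ?exprn_ge0 ?(ltW S0) ?(ltW c_gt0).
Unshelve. all: by end_near. Qed.

Lemma walk_path_law {dS : measure_display} {S : measurableType dS}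
    (Q : probability S R) (X : nat -> S -> int) N (A : pred (seq int)) :
  quenched_walk w Q X ->
  Q [set s | A [seq X i s | i <- iota 0 N.+1]] = (walk_prob w N 0 A)%:E.
Proof.
move=> [mX X0 stepX].
have supp_uniq x : uniq (walk_supp x).
  by rewrite /walk_supp /= inE andbT; apply/eqP; lia.
exact: (path_law Q int X walk_supp (step_prob w) mX supp_uniq (step_prob_sum1 w) stepX 0 N A X0).
Qed.

Section walk.
Context {dS : measure_display} {S : measurableType dS}.
Variables (Q : probability S R) (X : nat -> S -> int).
Hypothesis HX : quenched_walk w Q X.

Let u (beta : R) (n : nat) := cond_prob Q
  [set s | (n%:R : R) `^ beta <= (max_abs X (2 * n) s)%:R]
  [set s | X (2 * n)%N s = 0].

Let uE beta n : u beta n =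
  walk_prob w (2 * n) 0 (fun s => reaches (n%:R `^ beta) s && ends_at0 s) /
  walk_prob w (2 * n) 0 ends_at0.
Proof.
have lastE s : last 1 [seq X i s | i <- iota 0 (2 * n).+1] = X (2 * n)%N s.
  by rewrite -addn1 iotaD cats1 map_rcons last_rcons.
have maxE s : \max_(x <- [seq X i s | i <- iota 0 (2 * n).+1]) `|x|%N =
    max_abs X (2 * n) s.
  by rewrite big_map -[iota _ _]/(index_iota 0 (2 * n).+1) big_mkord.
have E1 := walk_path_law Q X (2 * n)
  (fun s => reaches (n%:R `^ beta) s && ends_at0 s) HX.
have E2 := walk_path_law Q X (2 * n) ends_at0 HX.
rewrite /u /cond_prob.
rewrite (_ : _ `&` _ = [set s | reaches (n%:R `^ beta) [seq X i s | i <- iota 0 (2 * n).+1] &&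
    ends_at0 [seq X i s | i <- iota 0 (2 * n).+1]]); last first.
  apply/seteqP; split => s; rewrite /mkset /reaches /ends_at0 lastE maxE.
    by move=> [H1 /eqP H2]; apply/andP.
  by move=> /andP[H1 /eqP H2].
rewrite E1 (_ : [set s | _ = _] = [set s | ends_at0 [seq X i s | i <- iota 0 (2 * n).+1]]) ?E2//.
by apply/seteqP; split => s; rewrite /mkset /ends_at0 lastE => /eqP.
Qed.

(** Lowering beta enlarges the event, which reduces the claim to an exponent in (alpha, 1). *)
Lemma bridge_far (beta : R) : alpha < beta -> u beta @ \oo --> (0 : R).
Proof.
move=> ab; pose b := (alpha + Num.min beta 1) / 2.
have mb : alpha < Num.min beta 1 by rewrite lt_min ab.
have m1 : Num.min beta 1 <= 1 by rewrite ge_min lexx orbT.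
have m2 : Num.min beta 1 <= beta by rewrite ge_min lexx.
have b1 : b < 1 by rewrite /b; lra.
have ba : alpha < b by rewrite /b; lra.
have bb : b <= beta by rewrite /b; lra.
apply: (squeeze_cvgr _ (cvg_cst 0) (far_ratio_cvg0 b ba b1)); near=> n.
have n0 : (0 < n)%N by near: n; exact: nbhs_infty_gt.
rewrite uE divr_ge0 ?walk_prob_ge0//=.
rewrite ler_wpM2r ?invr_ge0 ?walk_prob_ge0//; apply: walk_prob_le => s.
move=> /andP[H ->]; rewrite andbT; apply: reaches_le H; exact: powR_le_exp.
Unshelve. all: by end_near. Qed.

(** Raising beta shrinks the event, so nonpositive beta is covered by a positive exponent below
    alpha; there the complement has vanishing conditional probability. *)
Lemma bridge_near (beta : R) : beta < alpha -> u beta @ \oo --> (1 : R).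
Proof.
move=> ba; pose b := Num.max beta (alpha / 2).
have b0 : 0 < b by rewrite lt_max [X in _ || X]divr_gt0// orbT.
have ab : b < alpha by rewrite gt_max ba; move: alpha_gt0; lra.
have bb : beta <= b by rewrite le_max lexx.
pose v n := walk_prob w (2 * n) 0
    (fun s => ~~ reaches (n%:R `^ b) s && ends_at0 s) /
  walk_prob w (2 * n) 0 ends_at0.
have lim1 : (fun n => 1 - v n) @ \oo --> (1 : R).
  rewrite -[X in _ --> X]subr0; apply: cvgB; first exact: cvg_cst.
  exact: near_ratio_cvg0.
(* Only positivity of the conditioning probability is wanted, since [cond_prob] is 0 when it
   vanishes; any exponent in (alpha, 1) will do. *)
have al : alpha < (alpha + 1) / 2 by move: alpha_lt1; lra.
have a1 : (alpha + 1) / 2 < 1 by move: alpha_lt1; lra.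
have [A DA] := near_return_ge ((alpha + 1) / 2) al a1.
apply: (squeeze_cvgr _ lim1 (cvg_cst (1 : R))); near=> n.
have n0 : (0 < n)%N by near: n; exact: nbhs_infty_gt.
have D1 : expR (- (A * n%:R `^ ((alpha + 1) / 2))) <= walk_prob w (2 * n) 0 ends_at0 by near: n.
have D0 : 0 < walk_prob w (2 * n) 0 ends_at0 by apply: lt_le_trans D1; exact: expR_gt0.
rewrite uE; apply/andP; split.
  rewrite /v lerBlDr -mulrDl ler_pdivlMr// mul1r.
  apply: le_trans (lerD (lexx _) (_ : walk_prob w (2 * n) 0 (fun s => ~~ reaches (n%:R `^ beta) s && ends_at0 s) <= _)).
    apply: le_trans (walk_probU _ _ _ _ _); apply: walk_prob_le => s es /=.
    by rewrite es !andbT orbN.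
  apply: walk_prob_le => s /andP[H ->]; rewrite andbT; apply: contra H.
  by apply: reaches_le; exact: powR_le_exp.
rewrite ler_pdivrMr// mul1r; apply: walk_prob_le => s.
by case/andP.
Unshelve. all: by end_near. Qed.

End walk.

End quenched_asymptotics.

(** * Words of independent letters *)

Section iid_words.
Context {R : realType} {K : nat}.
Variable p : 'I_K.+1 -> R.
Hypothesis p_ge0 : forall k, 0 <= p k.
Hypothesis p_sum1 : \sum_(k <- enum 'I_K.+1) p k = 1.

Let letters (_ : 'I_K.+1) := enum 'I_K.+1.

(** A word is the trajectory, after the dummy start [ord0], of a chain whose kernel ignores the
    current state; this makes [path_law] available for words. *)
Definition word_prob (n : nat) (A : pred (seq 'I_K.+1)) : R :=
  path_prob letters (fun _ => p) n ord0 (fun s => A (behead s)).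

Lemma path_word_prob n z A :
  path_prob letters (fun _ => p) n z A = word_prob n (fun s => A (z :: s)).
Proof. by case: n. Qed.

Lemma word_prob0 A : word_prob 0 A = (A [::])%:R.
Proof. by []. Qed.

Lemma word_probS n A : word_prob n.+1 A =
  \sum_k p k * word_prob n (fun s => A (k :: s)).
Proof.
rewrite /word_prob /= big_enum; apply: eq_bigr => k _.
by rewrite path_word_prob.
Qed.

Lemma word_prob_sum1 : \sum_k p k = 1.
Proof. by rewrite -[RHS]p_sum1 big_enum. Qed.

Lemma eq_word_prob n (A B : pred (seq 'I_K.+1)) : A =1 B -> word_prob n A = word_prob n B.
Proof. by move=> AB; apply: eq_path_prob => // s; rewrite AB. Qed.

Lemma word_prob_ge0 n A : 0 <= word_prob n A.
Proof. exact: path_prob_ge0. Qed.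

Lemma word_prob_predC n A : word_prob n (predC A) = 1 - word_prob n A.
Proof.
by rewrite /word_prob -path_prob_predC.
Qed.

Lemma word_prob_le1 n A : word_prob n A <= 1.
Proof. by rewrite -subr_ge0 -word_prob_predC word_prob_ge0. Qed.

Lemma word_prob_true n : word_prob n (fun _ => true) = 1.
Proof.
by elim: n => // n IH; rewrite word_probS -[RHS]word_prob_sum1; apply: eq_bigr => k _; rewrite IH mulr1.
Qed.

Lemma word_prob_false n : word_prob n (fun _ => false) = 0.
Proof. exact: path_prob0. Qed.

(** Markov's inequality for a product of mean at most r^n, by induction: fixing the first letter
    divides the threshold by [G k]. *)
Lemma word_prob_prod_gt (G : 'I_K.+1 -> R) (r t : R) n :
  (forall k, 0 < G k) -> \sum_k p k * G k <= r -> 0 < t ->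
  word_prob n (fun s => t < \prod_(k <- s) G k) <= r ^+ n / t.
Proof.
move=> G0 Gr; have r0 : 0 <= r.
  by apply: le_trans Gr; apply: sumr_ge0 => k _; rewrite mulr_ge0// ltW.
elim: n t => [|n IH] t t0.
  rewrite word_prob0 big_nil expr0 ler_pdivlMr//.
  by case: (ltP t 1) => [/ltW|_]; rewrite ?mul1r ?mul0r.
rewrite word_probS.
apply: (@le_trans _ _ (\sum_k (p k * G k) * (r ^+ n / t))).
  apply: ler_sum => k _; rewrite -mulrA ler_wpM2l//.
  rewrite (eq_word_prob _ _ (fun s => t / G k < \prod_(k <- s) G k)); last first.
    by move=> s; rewrite big_cons ltr_pdivrMr// mulrC.
  apply: le_trans (IH _ (divr_gt0 t0 (G0 k))) _.
  by rewrite invf_div mulrCA.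
rewrite -mulr_suml exprS -mulrA ler_wpM2r// divr_ge0 ?exprn_ge0//.
exact: ltW.
Qed.

Lemma word_prob_cat L n (A B : pred (seq 'I_K.+1)) :
  word_prob (L + n) (fun s => A (take L s) && B (drop L s)) =
  word_prob L A * word_prob n B.
Proof.
elim: L A => [|L IH] A.
  rewrite word_prob0 add0n (eq_word_prob _ _ (fun s => A [::] && B s)); last first.
    by move=> s; rewrite take0 drop0.
  by case: (A [::]); rewrite ?mul1r ?mul0r//= word_prob_false.
rewrite addSn !word_probS mulr_suml; apply: eq_bigr => k _.
by rewrite -mulrA -IH.
Qed.

Variable v : 'I_K.+1 -> R.

Fixpoint climbs (h : R) (s : seq 'I_K.+1) : bool :=
  (h <= 0) || (if s is k :: s' then climbs (h - v k) s' else false).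

Lemma climbsP h s : climbs h s ->
  exists2 l, (l <= size s)%N & h <= \sum_(k <- take l s) v k.
Proof.
elim: s h => [|k s IH] h /=; rewrite ?orbF.
  by move=> h0; exists 0%N => //; rewrite big_nil.
case/orP => [h0|/IH[l ls hl]].
  by exists 0%N => //; rewrite big_nil.
by exists l.+1 => //=; rewrite big_cons -lerBlDl.
Qed.

(* The one-step identities for k |-> exp(b v) and exp(a v) make
   exp(-b h) - r^L exp(-a h) a subsolution of the recursion in L; this replaces
   optional stopping for the martingale exp(b * sum v). *)
Lemma climbs_prob_ge (a b r M : R) (L : nat) (h : R) :
  0 <= a -> a <= b -> (forall k, v k <= M) -> 0 <= r -> - M <= h ->
  1 <= \sum_k p k * expR (b * v k) -> \sum_k p k * expR (a * v k) <= r ->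
  expR (- (b * M)) * (expR (- (b * h)) - r ^+ L * expR (- (a * h))) <=
  word_prob L (climbs h).
Proof.
move=> a0 ab vM r0 + sb sa.
have b0 : 0 <= b by apply: le_trans ab.
have base L' h' : - M <= h' -> h' <= 0 ->
    expR (- (b * M)) * (expR (- (b * h')) - r ^+ L' * expR (- (a * h'))) <= 1.
  move=> Mh h0; apply: (@le_trans _ _ (expR (- (b * M)) * expR (- (b * h')))).
    by rewrite ler_wpM2l ?expR_ge0// gerBl mulr_ge0 ?exprn_ge0 ?expR_ge0.
  rewrite -expRD -[leRHS]expR0 ler_expR -opprD -mulrDr oppr_le0 mulr_ge0//.
  by rewrite -lerBlDl sub0r.
have climbs1 L' h' : h' <= 0 -> word_prob L' (climbs h') = 1.
  by move=> h0; rewrite -(word_prob_true L'); apply: eq_word_prob => -[|k s] /=; rewrite h0.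
elim: L h => [|L IH] h Mh; have [h0|h0] := leP h 0.
- by rewrite climbs1// base.
- apply: le_trans (word_prob_ge0 _ _); rewrite mulr_ge0_le0 ?expR_ge0// expr0 mul1r.
  by rewrite subr_le0 ler_expR lerN2 ler_wpM2r// ltW.
- by rewrite climbs1// base.
rewrite word_probS.
apply: (@le_trans _ _ (\sum_k p k * (expR (- (b * M)) *
   (expR (- (b * (h - v k))) - r ^+ L * expR (- (a * (h - v k))))))); last first.
  apply: ler_sum => k _; rewrite ler_wpM2l//.
  rewrite (eq_word_prob _ _ (climbs (h - v k))) ?IH//.
    by rewrite lerBrDr; have := vM k; lra.
  by move=> s /=; rewrite leNgt h0.
rewrite [leRHS](_ : _ = expR (- (b * M)) * (expR (- (b * h)) * (\sum_k p k * expR (b * v k))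
   - r ^+ L * expR (- (a * h)) * (\sum_k p k * expR (a * v k)))); last first.
  rewrite !mulr_sumr -sumrB mulr_sumr; apply: eq_bigr => k _.
  by rewrite !mulrBr !opprB !expRD !expRN; ring.
rewrite ler_wpM2l ?expR_ge0// lerB//.
  by rewrite ler_peMr ?expR_ge0.
rewrite exprSr [leRHS]mulrAC ler_wpM2l// mulr_ge0 ?exprn_ge0 ?expR_ge0//.
Qed.

(** Climbs are sought only inside [B] disjoint blocks of [L] letters: some are missed, but the
    blocks are independent. *)
Fixpoint no_climb (h : R) (L B : nat) (s : seq 'I_K.+1) : bool :=
  if B is B'.+1 then ~~ climbs h (take L s) && no_climb h L B' (drop L s)
  else true.

Lemma no_climb_prob h L B :
  word_prob (B * L) (no_climb h L B) = (1 - word_prob L (climbs h)) ^+ B.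
Proof.
elim: B => [|B IH]; first exact: word_prob_true.
rewrite mulSn [LHS](word_prob_cat L (B * L) (predC (climbs h)) (no_climb h L B)).
by rewrite IH exprS word_prob_predC.
Qed.

Lemma no_climbPn h L B s : size s = (B * L)%N -> ~~ no_climb h L B s ->
  exists b l, (b + l <= B * L)%N /\ h <= \sum_(k <- take l (drop b s)) v k.
Proof.
elim: B s => [|B IH] s //= ss; rewrite negb_and negbK => /orP[/climbsP[l ls hl]|nc].
  exists 0%N, l; rewrite drop0 add0n; split.
    by move: ls; rewrite size_takel ?ss mulSn ?leq_addr// => /leq_trans; apply; exact: leq_addr.
  by move: hl; rewrite take_takel//; move: ls; rewrite size_takel// ss mulSn leq_addr.
have [|b [l [bl hl]]] := IH _ _ nc; first by rewrite size_drop ss mulSn addKn.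
exists (L + b)%N, l; split; first by rewrite mulSn -addnA leq_add2l.
by rewrite addnC -drop_drop.
Qed.

End iid_words.

(** * Law of the letters read off the environment *)

Section environment_letters.
Context {R : realType}.

Lemma measurable_site (x : int) :
  measurable_fun setT (fun w : environment R => w x).
Proof.
move=> _ B mB; rewrite setTI; apply: sub_sigma_algebra.
by exists x => //; exists B => //; rewrite setTI.
Qed.

Variable P : probability (environment R) R.
Hypothesis Hindep :
  mutually_independent P (fun (x : int) (w : environment R) => w x).
Hypothesis Hident :
  identically_distributed P (fun (x : int) (w : environment R) => w x).
Context {K : nat}.
Variable cell : R -> 'I_K.+1.
Hypothesis mcell : forall k, measurable (cell @^-1` [set k]).

Definition letter_prob (k : 'I_K.+1) : R :=
  fine (P [set w : environment R | cell (w 0) = k]).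

Let measurable_letter x k : measurable [set w : environment R | cell (w x) = k].
Proof.
by rewrite -[X in measurable X]setTI; exact: (measurable_site x measurableT _ (mcell k)).
Qed.

Lemma letter_probE x k :
  P [set w : environment R | cell (w x) = k] = (letter_prob k)%:E.
Proof.
rewrite /letter_prob fineK; last exact: fin_num_measure.
exact: Hident x 0 _ (mcell k).
Qed.

Lemma letter_prob_ge0 k : 0 <= letter_prob k.
Proof. exact: fine_ge0. Qed.

Lemma letter_prob_sum1 : \sum_(k <- enum 'I_K.+1) letter_prob k = 1.
Proof.
apply/EFin_inj; rewrite -sumEFin big_enum/=.
under eq_bigr do rewrite -(letter_probE 0).
pose F (k : 'I_K.+1) := [set w : environment R | cell (w 0) = k].
have FT : \big[setU/set0]_(k < K.+1) F k = setT.
  apply/seteqP; split => // w _; rewrite -bigcup_mkord_ord.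
  by exists (cell (w 0)) => //=; rewrite /F /= inord_val.
have mF k : measurable (F k) by exact: measurable_letter.
have tF : trivIset setT F by move=> i j _ _ [w [/= <- <-]].
have mT : measurable (\big[setU/set0]_(k < K.+1) F k) by rewrite FT.
have := @measure_semi_additive_ord _ _ _ P _ F mF tF mT.
by rewrite FT => <-; exact: probability_setT.
Qed.

Variable site : nat -> int.
Hypothesis site_inj : injective site.

(** [site] selects the reading direction: x, x - 1, ... for the drift and 1, 2, ... for the wells.
    Its injectivity makes the letters independent. *)
Definition word (n : nat) (w : environment R) : seq 'I_K.+1 :=
  [seq cell (w (site i)) | i <- iota 0 n].

Let cylinder_prob n (a : nat -> 'I_K.+1) :
  P [set w : environment R | forall i, (i < n)%N -> cell (w (site i)) = a i] =
  (\prod_(i < n) letter_prob (a i))%:E.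
Proof.
pose s := [seq site i | i <- iota 0 n].
pose B (x : int) : set R := cell @^-1` [set a (index x s)].
have us : uniq s by rewrite map_inj_uniq ?iota_uniq.
have idx i : (i < n)%N -> index (site i) s = i.
  move=> ni; have -> : site i = nth 0 s i.
    by rewrite (nth_map 0%N) ?size_iota// nth_iota.
  by rewrite index_uniq// size_map size_iota.
have := Hindep s B us (fun x => mcell _); rewrite big_map.
rewrite (_ : iota 0 n = index_iota 0 n) ?big_mkord; last by rewrite /index_iota subn0.
rewrite (eq_bigr (fun i : 'I_n => (letter_prob (a i))%:E)); last first.
  by move=> i _; rewrite -(letter_probE (site i)) /B idx.
rewrite prodEFin => <-; congr (P _); apply/seteqP; split => w /= H.
  move=> x /= /mapP[i]; rewrite mem_iota add0n => /andP[_ ni] ->.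
  by rewrite /B /= idx// H.
move=> i ni; have := H (site i); rewrite /B /= idx//; apply.
by apply: map_f; rewrite mem_iota.
Qed.

(** The letters, preceded by a constant, form a Markov chain with a kernel that does not depend on
    the state; [path_law] then gives their joint law. *)
Lemma word_law n (A : pred (seq 'I_K.+1)) :
  P [set w | A (word n w)] = (word_prob letter_prob n A)%:E.
Proof.
pose X (i : nat) (w : environment R) := if i is j.+1 then cell (w (site j)) else ord0.
have mX i k : measurable (X i @^-1` [set k]).
  case: i => [|i]; last exact: measurable_letter.
  have [->|k0] := eqVneq k ord0.
    by rewrite (_ : _ @^-1` _ = setT)//; apply/seteqP; split.
  rewrite (_ : _ @^-1` _ = set0)//; apply/seteqP; split => //= w /= k0'.
  by rewrite -k0' eqxx in k0.
have stepX (m : nat) (a : nat -> 'I_K.+1) (y : 'I_K.+1) :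
    P [set w | (forall i, (i <= m)%N -> X i w = a i) /\ X m.+1 w = y] =
    ((letter_prob y)%:E * P [set w | forall i, (i <= m)%N -> X i w = a i])%E.
  (* A prescribed path that does not start at the constant [ord0] makes both sides vanish. *)
  have [a0|a0] := eqVneq (a 0%N) ord0; last first.
    rewrite (_ : [set w | _ /\ _] = set0) ?measure0.
      rewrite (_ : [set w | _] = set0) ?measure0 ?mule0//.
      by apply/seteqP; split => // w /(_ 0%N isT) /= E; rewrite -E eqxx in a0.
    by apply/seteqP; split => // w [/(_ 0%N isT) /= E _]; rewrite -E eqxx in a0.
  pose a' i := if i == m then y else a i.+1.
  have -> : [set w | forall i, (i <= m)%N -> X i w = a i] =
      [set w : environment R | forall i, (i < m)%N -> cell (w (site i)) = a i.+1].
    apply/seteqP; split => w /= H; first by move=> i im; exact: (H i.+1).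
    by case => [|i] im; [rewrite a0|exact: H].
  have -> : [set w | (forall i, (i <= m)%N -> X i w = a i) /\ X m.+1 w = y] =
      [set w : environment R | forall i, (i < m.+1)%N -> cell (w (site i)) = a' i].
    apply/seteqP; split => w /=.
      move=> [H Hy] i; rewrite ltnS leq_eqVlt /a'; case: eqP => [->//|_ /= im].
      exact: (H i.+1).
    move=> H; split; last by have := H m (ltnSn m); rewrite /a' eqxx.
    case=> [|i] im; first by rewrite a0.
    by have := H i (leqW im); rewrite /a' ltn_eqF.
  rewrite (cylinder_prob m (fun i => a i.+1)) cylinder_prob big_ord_recr /= EFinM muleC.
  congr (_%:E * _%:E)%E; first by rewrite /a' eqxx.
  by apply: eq_bigr => i _; rewrite /a' ltn_eqF.
have X0 : P [set w | X 0%N w = ord0] = 1%E.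
  by rewrite -(probability_setT P); congr (P _); apply/seteqP; split.
have := path_law P 'I_K.+1 X (fun=> enum 'I_K.+1) (fun _ => letter_prob) mX
  (fun=> enum_uniq _) (fun=> letter_prob_sum1) stepX ord0 n (fun s => A (behead s)) X0.
rewrite -/(word_prob _ _ _) => <-; congr (P _); apply: eq_set => w.
by rewrite /= -[iota 1 n]/(iota (1 + 0) n) iotaDl -map_comp.
Qed.

Lemma measurable_word n (A : pred (seq 'I_K.+1)) : measurable [set w | A (word n w)].
Proof.
pose X (i : nat) (w : environment R) := cell (w (site i)).
exact: (measurable_path _ X (fun i k => measurable_letter (site i) k) n A).
Qed.

End environment_letters.

(** * Moments of rho *)

Section moments.
Context {R : realType}.

Definition lnrho (r : R) : R := ln (1 - r) - ln r.

Lemma ln_rhoE (w : environment R) x : ln (rho w x) = lnrho (w x).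
Proof.
by rewrite /rho /lnrho ln_div ?posrE ?subr_gt0 ?env_gt0 ?env_lt1.
Qed.

Lemma powR_rhoE (w : environment R) x a : rho w x `^ a = expR (a * lnrho (w x)).
Proof. by rewrite /powR gt_eqF ?rho_gt0// ln_rhoE. Qed.

Lemma measurable_lnrho : measurable_fun setT lnrho.
Proof.
apply: measurable_funB; last exact: measurable_ln.
apply: (measurableT_comp (@measurable_ln R)).
by apply: measurable_funB.
Qed.

(** Strict convexity of exp between 0 and z: divide by exp(tz) and use 1 + u <= exp u, which is
    strict at u = (1 - t) z. *)
Lemma young_exp_strict (t z : R) : 0 < t < 1 -> z != 0 ->
  expR (t * z) < 1 - t + t * expR z.
Proof.
move=> /andP[t0 t1] z0.
have e1 : expR z = expR (t * z) * expR ((1 - t) * z).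
  by rewrite -expRD; congr expR; ring.
have e2 : 1 = expR (t * z) * expR (- (t * z)) :> R by rewrite -expRD subrr expR0.
have h1 : 1 + (1 - t) * z < expR ((1 - t) * z).
  by apply: expR_gt1Dx; rewrite mulf_neq0// subr_eq0 gt_eqF.
have h2 := expR_ge1Dx (- (t * z)).
rewrite [ltRHS](_ : _ = expR (t * z) * ((1 - t) * expR (- (t * z)) + t * expR ((1 - t) * z))); last first.
  rewrite [RHS](_ : _ = (1 - t) * (expR (t * z) * expR (- (t * z))) +
      t * (expR (t * z) * expR ((1 - t) * z))); last by ring.
  by rewrite -e2 -e1 mulr1.
rewrite ltr_pMr ?expR_gt0//.
have h1' : t * (1 + (1 - t) * z) < t * expR ((1 - t) * z) by rewrite ltr_pM2l.
have h2' : (1 - t) * (1 - t * z) <= (1 - t) * expR (- (t * z)).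
  by rewrite ler_wpM2l// subr_ge0 ltW.
rewrite [ltLHS](_ : _ = (1 - t) * (1 - t * z) + t * (1 + (1 - t) * z)); last by ring.
exact: ler_ltD.
Qed.

Lemma young_exp (t z : R) : 0 < t < 1 -> expR (t * z) <= 1 - t + t * expR z.
Proof.
move=> t01; have [->|z0] := eqVneq z 0; last exact/ltW/young_exp_strict.
by rewrite mulr0 expR0; lra.
Qed.

Variable P : probability (environment R) R.

Definition moment (a : R) : \bar R :=
  (\int[P]_w (expR (a * lnrho (w 0)))%:E)%E.

Lemma measurable_moment a :
  measurable_fun setT (fun w : environment R => expR (a * lnrho (w 0))).
Proof.
apply: (measurableT_comp (@measurable_expR R)).
apply: measurable_funM => //.
exact: (measurableT_comp measurable_lnrho (measurable_site 0)).
Qed.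

Lemma expectation_rho a :
  ('E_P[(fun w : environment R => (rho w 0 `^ a)%R)] = moment a)%E.
Proof.
by rewrite unlock; apply: eq_integral => w _; rewrite powR_rhoE.
Qed.

Lemma moment_ge0 a : (0 <= moment a)%E.
Proof. by apply: integral_ge0 => w _; rewrite lee_fin expR_ge0. Qed.

Hypothesis Hlt : (0 < P [set w : environment R | (w 0 < 2^-1)%R])%E.

(** [e] is the integral of the convexity gap, positive because ln rho > 0 has positive probability.
    Adding it on the left keeps the identity meaningful when [moment b] is infinite. *)
Lemma moment_young (t b : R) : 0 < t < 1 -> b != 0 ->
  exists e : \bar R, (0 < e)%E /\
    (moment (t * b) + e = (1 - t)%:E + t%:E * moment b)%E.
Proof.
move=> /[dup] t01 /andP[t0 t1] b0.
pose h (w : environment R) := 1 - t + t * expR (b * lnrho (w 0)) - expR (t * b * lnrho (w 0)).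
have h0 w : 0 <= h w.
  by rewrite /h subr_ge0 -mulrA; exact: young_exp.
have mh : measurable_fun setT h.
  apply: measurable_funB; last exact: measurable_moment.
  apply: measurable_funD => //; apply: measurable_funM => //; exact: measurable_moment.
exists (\int[P]_w (h w)%:E)%E; split.
  rewrite lt0e integral_ge0 ?andbT; last by move=> w _; rewrite lee_fin.
  apply/negP => /eqP h_0.
  have habs : (\int[P]_w `|(h w)%:E| = 0)%E.
    by rewrite -[RHS]h_0; apply: eq_integral => w _; rewrite gee0_abs ?lee_fin.
  have mhE : measurable_fun setT (EFin \o h) by exact/measurable_EFinP.
  have [/(_ habs) [N [mN N0 hN]] _] := ae_eq_integral_abs P measurableT mhE.
  move: Hlt; rewrite lt0e => /andP[/negP + _]; apply; apply/eqP.
  have mlt : measurable [set w : environment R | w 0 < 2^-1].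
    rewrite -[X in measurable X]setTI.
    rewrite (_ : [set w : environment R | _] = (fun w : environment R => w 0) @^-1` `]-oo, 2^-1[%classic).
      exact: (measurable_site 0 measurableT _ (measurable_itv _)).
    by apply/seteqP; split => w /=; rewrite in_itv.
  apply: (subset_measure0 _ mN _ N0) => // w /= w12.
  apply: hN => /(_ I) /= -[]; apply/eqP; rewrite gt_eqF//.
  rewrite /h subr_gt0 -mulrA; apply: young_exp_strict => //.
  rewrite mulf_neq0// gt_eqF// /lnrho subr_gt0 ltr_ln ?posrE ?subr_gt0 ?env_gt0 ?env_lt1//.
  by have := env_gt0 w 0; lra.
have mE a : measurable_fun setT (fun w : environment R => (expR (a * lnrho (w 0)))%:E).
  by apply/measurable_EFinP; exact: measurable_moment.
have E0 a (w : environment R) : (0 <= (expR (a * lnrho (w 0)))%:E)%E by rewrite lee_fin expR_ge0.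
rewrite -(@ge0_integralD _ _ _ P setT measurableT (fun w => (expR (t * b * lnrho (w 0)))%:E)
  (fun w => (h w)%:E))//; [|by move=> w _; rewrite lee_fin|exact/measurable_EFinP].
transitivity (\int[P]_w ((1 - t)%:E + t%:E * (expR (b * lnrho (w 0)))%:E))%E.
  by apply: eq_integral => w _; rewrite -EFinD -EFinM -EFinD /h; congr EFin; ring.
have t0' : (0 <= t%:E)%E by rewrite lee_fin ltW.
rewrite (@ge0_integralD _ _ _ P setT measurableT (fun w => (1 - t)%:E)
  (fun w => t%:E * (expR (b * lnrho (w 0)))%:E)%E)//.
- have PT : P setT = 1%E by exact: probability_setT.
  by rewrite integral_cst//= PT mule1 ge0_integralZl.
- by move=> w _; rewrite lee_fin subr_ge0 ltW.
- by move=> w _; rewrite mule_ge0.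
- by apply/measurable_EFinP; apply: measurable_funM => //; exact: measurable_moment.
Qed.

Variable kappa : R.
Hypothesis kappa_gt0 : 0 < kappa.
Hypothesis Hkappa : (moment kappa = 1)%E.

(** a is a proper convex combination of 0 and kappa, where the moment is 1. *)
Lemma moment_lt1 a : 0 < a -> a < kappa -> (moment a < 1)%E.
Proof.
move=> a0 ak; pose t := a / kappa.
have t01 : 0 < t < 1 by rewrite /t divr_gt0//= ltr_pdivrMr// mul1r.
have [e [e0]] := moment_young t kappa t01 (lt0r_neq0 kappa_gt0).
rewrite Hkappa mule1 -EFinD subrK divfK ?lt0r_neq0// => E.
have := moment_ge0 a; have mfin : moment a \is a fin_num.
  rewrite ge0_fin_numE ?moment_ge0//; apply: le_lt_trans (ltry 1).
  by rewrite -E leeDl// ltW.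
by move=> _; rewrite -E lteDl.
Qed.

(** Now kappa lies strictly between 0 and a: a moment at most 1 at a would force one strictly below
    1 at kappa. *)
Lemma moment_gt1 a : kappa < a -> (1 < moment a)%E.
Proof.
move=> ka; pose t := kappa / a; have a0 : 0 < a by apply: lt_trans ka.
have t01 : 0 < t < 1 by rewrite /t divr_gt0//= ltr_pdivrMr// mul1r.
have t0 : 0 < t by case/andP: t01.
have [e [e0]] := moment_young t a t01 (lt0r_neq0 a0).
rewrite divfK ?lt0r_neq0// Hkappa => E.
rewrite ltNge; apply/negP => m1.
have : (1 + e <= 1)%E.
  rewrite E -[leRHS](_ : ((1 - t)%:E + t%:E * 1 = 1)%E); last first.
    by rewrite mule1 -EFinD subrK.
  by rewrite leeD2l// lee_wpmul2l// lee_fin ltW.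
by rewrite leNgt lteDl// e0.
Qed.

End moments.

(** * Rounding ln rho to a finite grid *)

Section discretisation.
Context {R : realType}.
Variable P : probability (environment R) R.
Hypothesis Hindep :
  mutually_independent P (fun (x : int) (w : environment R) => w x).
Hypothesis Hident :
  identically_distributed P (fun (x : int) (w : environment R) => w x).
Variables (c del : R).
Hypothesis c_gt0 : 0 < c.
Hypothesis del_gt0 : 0 < del.
Hypothesis Hell : forall x : int, P [set w : environment R | c <= w x <= 1 - c] = 1%E.

Definition log_bound : R := ln (1 - c) - ln c.

Definition grid_size : nat := Num.truncn (2 * log_bound / del).

(* Meaningful only for |lnrho r| <= log_bound, i.e. c <= r <= 1 - c; other
   values of r get a boundary cell. *)
Definition cell (r : R) : 'I_grid_size.+1 :=
  inord (minn grid_size (Num.truncn ((lnrho r + log_bound) / del))).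

Definition cell_val (k : 'I_grid_size.+1) : R := - log_bound + k%:R * del.

Let cellE r : cell r = minn grid_size (Num.truncn ((lnrho r + log_bound) / del)) :> nat.
Proof. by rewrite /cell inordK// ltnS geq_minl. Qed.

Lemma measurable_cell k : measurable (cell @^-1` [set k]).
Proof.
have mge (j : nat) : measurable [set r : R | (j <= cell r)%N].
  have [->|j0] := posnP j.
    by rewrite (_ : [set _ | _] = setT)//; apply/seteqP; split.
  have [jK|Kj] := leqP j grid_size; last first.
    rewrite (_ : [set _ | _] = set0)//; apply/seteqP; split => // r /=.
    by rewrite leqNgt (leq_ltn_trans _ Kj)// -ltnS ltn_ord.
  pose f r := (lnrho r + log_bound) / del.
  have mf : measurable_fun setT f.
    by apply: measurable_funM => //; apply: measurable_funD => //; exact: measurable_lnrho.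
  rewrite (_ : [set _ | _] = f @^-1` `[j%:R, +oo[%classic).
    by rewrite -[X in measurable X]setTI; exact: (mf measurableT _ (measurable_itv _)).
  apply/seteqP; split => r /=; rewrite in_itv/= andbT cellE leq_min jK/=;
  by rewrite -(prednK j0) truncn_gt_nat.
rewrite (_ : _ @^-1` _ = [set r | (k <= cell r)%N] `\` [set r | (k.+1 <= cell r)%N]).
  exact: measurableD.
apply/seteqP; split => r /=; first by move=> ->; split => //; rewrite ltnn.
move=> [kr /negP]; rewrite -leqNgt => rk; apply: val_inj; apply/eqP.
by rewrite eqn_leq rk.
Qed.

(** The grid rounds down, so wells are detected with [cell_val] and the drift is bounded with
    [cell_val + del]. *)
Lemma cell_bounds r : c <= r <= 1 - c ->
  cell_val (cell r) <= lnrho r < cell_val (cell r) + del.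
Proof.
move=> /andP[cr rc]; have r0 : 0 < r by apply: lt_le_trans cr.
have rc1 : r + c <= 1 by rewrite -lerBrDr.
have r1 : 0 < 1 - r by move: rc1 c_gt0; lra.
have c1 : 0 < 1 - c by move: rc1 r0; lra.
have lb : - log_bound <= lnrho r.
  rewrite /lnrho /log_bound opprB; apply: lerB; rewrite ler_ln ?posrE//; move: rc1; lra.
have ub : lnrho r <= log_bound.
  by rewrite /lnrho /log_bound; apply: lerB; rewrite ler_ln ?posrE//; move: rc1 cr; lra.
pose f := (lnrho r + log_bound) / del.
have f0 : 0 <= f by rewrite divr_ge0 ?(ltW del_gt0)//; lra.
have fK : (Num.truncn f <= grid_size)%N.
  by apply: le_truncn; rewrite ler_pM2r ?invr_gt0//; lra.
have -> : cell_val (cell r) = - log_bound + (Num.truncn f)%:R * del.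
  by rewrite /cell_val cellE (minn_idPr fK).
have /andP[t1 t2] := truncn_itv f0.
rewrite ler_pdivlMr// in t1; rewrite ltr_pdivrMr// -natr1 mulrDl mul1r in t2.
by apply/andP; split; lra.
Qed.

Lemma cell_val_le k : cell_val k <= `|log_bound| + grid_size%:R * del.
Proof.
rewrite /cell_val lerD//; first by rewrite -normrN ler_norm.
by rewrite ler_wpM2r ?(ltW del_gt0)// ler_nat -ltnS.
Qed.

Let p := letter_prob P cell.

Lemma integral_cell (g : 'I_grid_size.+1 -> R) : (forall k, 0 <= g k) ->
  (\int[P]_w (g (cell (w 0)))%:E = (\sum_k p k * g k)%:E)%E.
Proof.
move=> g0; have mF k : measurable [set w : environment R | cell (w 0) = k].
  rewrite -[X in measurable X]setTI.
  exact: (measurable_site 0 measurableT _ (measurable_cell k)).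
transitivity (\int[P]_w (\sum_(k <- enum 'I_grid_size.+1)
    (g k)%:E * (\1_[set w : environment R | cell (w 0) = k] w)%:E))%E.
  apply: eq_integral => w _; rewrite big_enum/= (bigD1 (cell (w 0)))//= big1 ?adde0.
    by rewrite indicE mem_set// mule1.
  move=> k kw; rewrite indicE memNset ?mule0//= => E.
  by rewrite E eqxx in kw.
rewrite ge0_integral_sum//; last 2 first.
- move=> k; apply/measurable_EFinP; apply: measurable_funM => //.
- by move=> k w _; rewrite -EFinM lee_fin mulr_ge0.
rewrite -sumEFin big_enum/=; apply: eq_bigr => k _.
rewrite ge0_integralZl//.
- rewrite integral_indic// setIT mulrC EFinM; congr (_ * _)%E.
  exact: (letter_probE P Hident cell measurable_cell 0 k).
- by apply/measurable_EFinP.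
- by rewrite lee_fin.
Qed.

Let ae_ell : {ae P, forall w : environment R, c <= w 0 <= 1 - c}.
Proof.
have mA : measurable [set w : environment R | c <= w 0 <= 1 - c].
  rewrite -[X in measurable X]setTI.
  exact: (measurable_site 0 measurableT `[c, 1 - c]%classic (measurable_itv _)).
exists (~` [set w : environment R | c <= w 0 <= 1 - c]); split => //.
  exact: measurableC.
by rewrite probability_setC// Hell subee.
Qed.

Let measurable_cellf (g : 'I_grid_size.+1 -> R) :
  measurable_fun setT (fun w : environment R => (g (cell (w 0)))%:E).
Proof.
apply/measurable_EFinP => _ B mB; rewrite setTI.
rewrite (_ : _ @^-1` _ = \bigcup_(k in [set k | B (g k)]) [set w : environment R | cell (w 0) = k]).
  apply: fin_bigcup_measurable; first exact: finite_finset.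
  move=> k _; rewrite -[X in measurable X]setTI.
  exact: (measurable_site 0 measurableT _ (measurable_cell k)).
apply/seteqP; split => w /=; first by exists (cell (w 0)).
by move=> [k /= Bk ->].
Qed.

Let p_sumE (a s : R) : (\sum_k p k * expR (a * (cell_val k + s)))%:E =
  (\int[P]_w (expR (a * (cell_val (cell (w 0)) + s)))%:E)%E.
Proof.
by rewrite -(integral_cell (fun k => expR (a * (cell_val k + s))))// => k; exact: expR_ge0.
Qed.

Lemma cell_moment_le (a : R) : 0 <= a ->
  ((\sum_k p k * expR (a * cell_val k))%:E <= moment P a)%E.
Proof.
move=> a0.
rewrite -(integral_cell (fun k => expR (a * cell_val k))); last by move=> k; exact: expR_ge0.
apply: ae_ge0_le_integral; first exact: measurableT.
- by move=> w _; rewrite lee_fin expR_ge0.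
- exact: (measurable_cellf (fun k => expR (a * cell_val k))).
- by move=> w _; rewrite lee_fin expR_ge0.
- by apply/measurable_EFinP; exact: measurable_moment.
apply: filterS ae_ell => w wc _; rewrite lee_fin ler_expR ler_wpM2l//.
by have /andP[] := cell_bounds _ wc.
Qed.

Lemma cell_moment_ge (a : R) : 0 <= a ->
  (moment P a <= (\sum_k p k * expR (a * (cell_val k + del)))%:E)%E.
Proof.
move=> a0; rewrite p_sumE; apply: ae_ge0_le_integral; first exact: measurableT.
- by move=> w _; rewrite lee_fin expR_ge0.
- by apply/measurable_EFinP; exact: measurable_moment.
- by move=> w _; rewrite lee_fin expR_ge0.
- exact: (measurable_cellf (fun k => expR (a * (cell_val k + del)))).
apply: filterS ae_ell => w wc _; rewrite lee_fin ler_expR ler_wpM2l//.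
by have /andP[_ /ltW] := cell_bounds _ wc.
Qed.

End discretisation.

(** * Almost sure properties of the environment *)

Section summable_bounds.
Context {R : realType}.

Lemma geometric_sum_le (x : R) (n : nat) : 0 <= x -> x < 1 ->
  \sum_(i < n) x ^+ i <= (1 - x)^-1.
Proof.
move=> x0 x1; have x1' : 0 < 1 - x by rewrite subr_gt0.
rewrite -[leRHS]mul1r ler_pdivlMr// mulrC -opprB mulNr -subrX1 opprB.
by rewrite lerBlDl lerDr exprn_ge0.
Qed.

(** Telescoping: s (k+2)^(-1-s) <= (k+1)^(-s) - (k+2)^(-s), which follows from exp u >= 1 + u and
    ln(1 - 1/(k+2)) <= -1/(k+2). *)
Lemma powR_sum_le (s : R) (n : nat) : 0 < s ->
  \sum_(i < n) i.+1%:R `^ (- (1 + s)) <= 1 + s^-1 :> R.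
Proof.
move=> s0.
have step (k : nat) : s * k.+2%:R `^ (- (1 + s)) <= k.+1%:R `^ (- s) - k.+2%:R `^ (- s) :> R.
  have k1 : (0 : R) < k.+1%:R by rewrite ltr0n.
  have k2 : (0 : R) < k.+2%:R by rewrite ltr0n.
  have -> : k.+1%:R `^ (- s) = k.+2%:R `^ (- s) * expR (s * (ln k.+2%:R - ln k.+1%:R)) :> R.
    by rewrite /powR !gt_eqF// -expRD; congr expR; ring.
  have -> : k.+2%:R `^ (- (1 + s)) = k.+2%:R `^ (- s) * k.+2%:R^-1 :> R.
    rewrite opprD addrC powRD ?powR_inv1 ?ler0n//.
    by apply/implyP => _; rewrite gt_eqF.
  rewrite mulrCA -[X in _ <= _ - X]mulr1 -mulrBr ler_wpM2l ?powR_ge0// lerBrDl.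
  apply: le_trans (expR_ge1Dx _); rewrite lerD2l ler_wpM2l ?(ltW s0)//.
  have /le_ln1Dx : -1 < - (k.+2%:R^-1) :> R.
    by rewrite ltrN2 invf_lt1// ltr1n.
  have -> : 1 - k.+2%:R^-1 = k.+1%:R / k.+2%:R :> R.
    by rewrite -[k.+1%:R](addrK 1) natr1 mulrBl divff ?mul1r// gt_eqF.
  by rewrite ln_div ?posrE// => lnk; rewrite -lerN2 opprB.
suff H : \sum_(i < n.+1) i.+1%:R `^ (- (1 + s)) <= 1 + (1 - n.+1%:R `^ (- s)) / s :> R.
  have : \sum_(i < n) i.+1%:R `^ (- (1 + s)) <= \sum_(i < n.+1) i.+1%:R `^ (- (1 + s)) :> R.
    by rewrite big_ord_recr/= lerDl powR_ge0.
  move=> /le_trans; apply; apply: (le_trans H); rewrite lerD2l -[leRHS]mul1r.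
  by rewrite ler_wpM2r ?invr_ge0 ?(ltW s0)// gerBl powR_ge0.
elim: n => [|n IH]; first by rewrite big_ord_recr big_ord0/= !powR1 subrr mul0r addr0 add0r.
rewrite big_ord_recr/=; apply: (le_trans (lerD IH (lexx _))).
rewrite -addrA lerD2l -lerBrDl -mulrBl ler_pdivlMr// mulrC.
by apply: (le_trans (step n)); rewrite opprB [leRHS]addrC addrA subrK.
Qed.

Context {d : measure_display} {T : measurableType d}.
Variable P : probability T R.

Lemma nneseries_le (u : nat -> \bar R) (f : nat -> R) (S : R) :
  (forall n, (0 <= u n)%E) -> (forall n, (u n <= (f n)%:E)%E) ->
  (forall N, \sum_(i < N) f i <= S) -> (\sum_(n <oo) u n <= S%:E)%E.
Proof.
move=> u0 uf fS; apply: lime_le; first by apply: is_cvg_nneseries.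
apply: nearW => N; rewrite big_mkord.
apply: le_trans (_ : (\sum_(i < N) (f i)%:E <= _)%E); first exact: lee_sum.
by rewrite sumEFin lee_fin.
Qed.

Lemma measure_bigcup_le (F : nat -> set T) (f : nat -> R) (S : R) :
  (forall n, measurable (F n)) -> (forall n, (P (F n) <= (f n)%:E)%E) ->
  (forall N, \sum_(i < N) f i <= S) -> (P (\bigcup_n F n) <= S%:E)%E.
Proof.
move=> mF Pf fS.
apply: le_trans (nneseries_le (fun n => P (F n)) f S _ Pf fS); last by [].
apply: (measure_sigma_subadditive P) => //.
exact: bigcupT_measurable.
Qed.

Lemma null_of_le_inv (N : set T) (S : R) : measurable N ->
  (forall M : nat, (P N <= (S / M.+1%:R)%:E)%E) -> P N = 0%E.
Proof.
move=> mN H; apply/eqP; rewrite eq_le measure_ge0 andbT.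
have fN : P N \is a fin_num by exact: fin_num_measure.
rewrite -(fineK fN) lee_fin leNgt; apply/negP => p0.
have := H (Num.truncn (S / fine (P N))); rewrite -{1}(fineK fN) lee_fin.
apply/negP; rewrite -ltNge ltr_pdivrMr ?ltr0n// mulrC -ltr_pdivrMr//.
exact: truncnS_gt.
Qed.

End summable_bounds.

Section almost_sure_environment.
Context {R : realType}.
Variable P : probability (environment R) R.
Hypothesis Hindep :
  mutually_independent P (fun (x : int) (w : environment R) => w x).
Hypothesis Hident :
  identically_distributed P (fun (x : int) (w : environment R) => w x).
Variable c : R.
Hypothesis c_gt0 : 0 < c.
Hypothesis Hell : forall x : int, P [set w : environment R | c <= w x <= 1 - c] = 1%E.

Lemma ae_elliptic : {ae P, forall w : environment R, forall x, c <= w x <= 1 - c}.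
Proof.
have mA x : measurable [set w : environment R | c <= w x <= 1 - c].
  rewrite -[X in measurable X]setTI.
  exact: (measurable_site x measurableT `[c, 1 - c]%classic (measurable_itv _)).
have H x : {ae P, forall w : environment R, c <= w x <= 1 - c}.
  exists (~` [set w : environment R | c <= w x <= 1 - c]); split => //.
    exact: measurableC.
  by rewrite probability_setC// Hell subee.
have H1 := ae_foralln (fun n => H n%:Z).
have H2 := ae_foralln (fun n => H (- n%:Z)).
apply: filterS2 H1 H2 => w w1 w2 x.
by case: x => n; [exact: w1|rewrite NegzE; exact: w2].
Qed.

(** * Drift bound by summing over all sites and lengths *)

Section drift.
Variables (a q del r : R).
Hypothesis a_gt0 : 0 < a.
Hypothesis del_gt0 : 0 < del.
Hypothesis aq : 1 < q * a.
Hypothesis r01 : 0 < r < 1.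

Let p := letter_prob P (cell c del).
Let G (k : 'I_(grid_size c del).+1) := expR (a * (cell_val c del k + del)).

Hypothesis Gr : \sum_k p k * G k <= r ^+ 2.

Let mcell := measurable_cell c del.

(** The moment bound r^2 is split: one factor r per letter lowers the threshold and becomes the
    drift, the other makes the Chernoff bound summable in n. The power qa > 1 gives summability over
    the sites, and M + 1 makes the total small. *)
Let bound (M j n : nat) : R := M.+1%:R * j.+1%:R `^ (q * a) * r ^+ n.

Let bad (x : int) (M n : nat) : set (environment R) :=
  [set w | bound M `|x| n < \prod_(k <- word (cell c del) (fun i => x - i%:Z) n w) G k].

Let bad_le x M n : (P (bad x M n) <=
  ((M.+1%:R^-1 * `|x|.+1%:R `^ (- (q * a))) * r ^+ n)%:E)%E.
Proof.
have inj : injective (fun i : nat => x - i%:Z) by move=> i j; lia.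
have /andP[r0 r1] := r01.
have pos : 0 < bound M `|x| n.
  by rewrite /bound !mulr_gt0 ?ltr0n ?powR_gt0 ?exprn_gt0.
rewrite (word_law P Hindep Hident (cell c del) mcell _ inj n
  (fun s => bound M `|x| n < \prod_(k <- s) G k)) lee_fin.
apply: le_trans (word_prob_prod_gt p _ G (r ^+ 2) _ n _ Gr pos) _.
- exact: letter_prob_ge0.
- by move=> k; exact: expR_gt0.
rewrite /bound powRN ler_pdivrMr// -exprM mulnC exprM expr2.
rewrite [leRHS](_ : _ = r ^+ n * r ^+ n * (M.+1%:R^-1 * M.+1%:R) *
  ((`|x|.+1%:R `^ (q * a))^-1 * `|x|.+1%:R `^ (q * a))); last by ring.
by rewrite !mulVf ?mulr1 ?exprMn// gt_eqF ?powR_gt0 ?ltr0n.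
Qed.

Let mbad x M n : measurable (bad x M n).
Proof.
exact: (measurable_word (cell c del) mcell (fun i => x - i%:Z) n
  (fun s => bound M `|x| n < \prod_(k <- s) G k)).
Qed.

Let S : R := (1 + (q * a - 1)^-1) * (1 - r)^-1.

Let bad_union_le (site : nat -> int) M : (forall n, `|site n|%N = n) ->
  (P (\bigcup_j \bigcup_n bad (site j) M n) <= (S / M.+1%:R)%:E)%E.
Proof.
move=> siteE; have /andP[r0 r1] := r01.
have i1 : 0 <= (1 - r)^-1 by rewrite invr_ge0 subr_ge0 ltW.
apply: (measure_bigcup_le P _ (fun j => M.+1%:R^-1 * j.+1%:R `^ (- (q * a)) * (1 - r)^-1)).
- by move=> j; exact: bigcupT_measurable.
- move=> j; apply: (measure_bigcup_le P _ (fun n => M.+1%:R^-1 * j.+1%:R `^ (- (q * a)) * r ^+ n)).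
  + by move=> n; exact: mbad.
  + by move=> n; have := bad_le (site j) M n; rewrite siteE.
  + move=> N; rewrite -mulr_sumr ler_wpM2l ?mulr_ge0 ?invr_ge0 ?powR_ge0//.
    by apply: geometric_sum_le => //; exact: ltW.
- move=> N; rewrite -mulr_suml -mulr_sumr.
  rewrite [leRHS](_ : _ = M.+1%:R^-1 * (1 + (q * a - 1)^-1) * (1 - r)^-1); last first.
    by rewrite /S; ring.
  rewrite ler_wpM2r// ler_wpM2l ?invr_ge0//.
  have qa : 0 < q * a - 1 by rewrite subr_gt0.
  have := powR_sum_le (q * a - 1) N qa; by rewrite [1 + (q * a - 1)]addrC subrK.
Qed.

Let good_drift (w : environment R) : (forall x, c <= w x <= 1 - c) ->
  (exists M, forall x n, ~ bad x M n w) -> drift_bound w q.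
Proof.
move=> wc [M nb]; have /andP[r0 r1] := r01.
(* Logarithm of the threshold divided by a; the power q a of the site turns into the coefficient
   q. *)
exists (ln M.+1%:R / a), (- ln r / a); split.
  by rewrite divr_gt0// oppr_gt0 ln_lt0// r0.
move=> x n; have := nb x n => /negP; rewrite -leNgt => H.
have E : expR (a * log_sum_down w x n) <= bound M `|x| n.
  apply: le_trans H; rewrite /word big_map /log_sum_down mulr_sumr expR_sum.
  rewrite (_ : iota 0 n = index_iota 0 n) ?big_mkord; last by rewrite /index_iota subn0.
  apply: ler_prod => i _; rewrite expR_ge0/= /G ler_expR ler_wpM2l ?(ltW a_gt0)//.
  rewrite ln_rhoE; have := cell_bounds c del c_gt0 del_gt0 _ (wc (x - i%:Z)).
  by case/andP => _ /ltW.
have pos : 0 < bound M `|x| n.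
  by rewrite /bound !mulr_gt0 ?ltr0n ?powR_gt0 ?exprn_gt0.
move: E; rewrite -[X in _ <= X]lnK ?posrE// ler_expR.
rewrite /bound !lnM ?posrE ?mulr_gt0 ?powR_gt0 ?exprn_gt0 ?ltr0n// ln_powR lnXn//.
rewrite mulrC -ler_pdivlMr// => /le_trans; apply.
rewrite nat1r -mulr_natr le_eqVlt; apply/orP; left; apply/eqP.
by field; rewrite gt_eqF.
Qed.

(** The exceptional sets shrink as M grows and have mass O(1/M), so their intersection is null. The
    two half-lines are treated apart so that sites are indexed by |x|. *)
Lemma ae_drift_of_cells : {ae P, forall w : environment R, drift_bound w q}.
Proof.
have H (site : nat -> int) : (forall n, `|site n|%N = n) ->
    {ae P, forall w : environment R, exists M0, forall M, (M0 <= M)%N -> forall j n, ~ bad (site j) M n w}.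
  move=> siteE; pose F M := \bigcup_j \bigcup_n bad (site j) M n.
  have mF M : measurable (F M).
    by apply: bigcupT_measurable => j; exact: bigcupT_measurable.
  exists (\bigcap_M F M); split.
  - exact: bigcapT_measurable.
  - apply: (null_of_le_inv P _ S); first exact: bigcapT_measurable.
    move=> M; apply: le_trans (bad_union_le site M siteE).
    apply: le_measure.
    + by rewrite inE; exact: bigcapT_measurable.
    + by rewrite inE; exact: mF.
    + by move=> w; apply.
  - move=> w /= nw M _; apply: contrapT => nF; apply: nw; exists M => M' MM' j n.
    move=> b; apply: nF; exists j => //; exists n => //.
    apply: le_lt_trans b; rewrite /bound !ler_wpM2r ?exprn_ge0 ?powR_ge0//.
      by case/andP: r01 => /ltW.
    by rewrite ler_nat.
have H1 := H (fun j => j%:Z) (fun j => erefl).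
have H2 := H (fun j => - j%:Z) (fun j => abszN _).
apply: filterS3 H1 H2 ae_elliptic => w [M1 w1] [M2 w2] wc.
apply: good_drift => //; exists (maxn M1 M2) => x n.
case: x => j; first exact: (w1 _ (leq_maxl _ _)).
by rewrite NegzE; exact: (w2 _ (leq_maxr _ _)).
Qed.

End drift.

(** * Wells from independent blocks *)

Section wells.
Variables (a b del r q : R).
Hypothesis a_ge0 : 0 <= a.
Hypothesis ab : a <= b.
Hypothesis del_gt0 : 0 < del.
Hypothesis q_gt0 : 0 < q.
Hypothesis qb : q * b < 1.
Hypothesis r01 : 0 < r < 1.

Let p := letter_prob P (cell c del).
Let v := cell_val c del.

Hypothesis vb : 1 <= \sum_k p k * expR (b * v k).
Hypothesis va : \sum_k p k * expR (a * v k) <= r.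

Let mcell := measurable_cell c del.
Let p_ge0 k : 0 <= p k. Proof. exact: letter_prob_ge0. Qed.
Let p_sum1 : \sum_(k <- enum 'I_(grid_size c del).+1) p k = 1.
Proof. exact: letter_prob_sum1. Qed.

Let site_inj : injective (fun i : nat => i%:Z + 1).
Proof. by move=> i j; clear; lia. Qed.

(** Chosen so that 1 - eta - qb = eta: about m^(1-eta) blocks of length m^eta, each climbing with
    probability at least of order m^(-qb), give at least of order m^eta successes on average. *)
Let eta := (1 - q * b) / 2.
Let eta_gt0 : 0 < eta. Proof. by rewrite divr_gt0// subr_gt0. Qed.

Let b_ge0 : 0 <= b. Proof. exact: le_trans ab. Qed.

Let len (m : nat) := (Num.truncn (m%:R `^ eta : R)).+1.
Let blocks (m : nat) := (m %/ len m)%N.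

Let fail (m : nat) : set (environment R) :=
  [set w | no_climb v (q * ln m%:R) (len m) (blocks m)
    (word (cell c del) (fun i => i%:Z + 1) (blocks m * len m) w)].

Let mfail m : measurable (fail m).
Proof.
exact: (measurable_word (cell c del) mcell (fun i => i%:Z + 1) (blocks m * len m)
  (no_climb v (q * ln m%:R) (len m) (blocks m))).
Qed.

Let len_ge m : m%:R `^ eta <= (len m)%:R :> R.
Proof. exact/ltW/truncnS_gt. Qed.

Let len_le m : (0 < m)%N -> (len m)%:R <= 2 * m%:R `^ eta :> R.
Proof.
move=> m0; have [_ h1 _] := truncn_powR_bounds eta m (ltW eta_gt0) m0.
have := powR_ge1 eta m (ltW eta_gt0) m0.
by rewrite /len -natr1; lra.
Qed.

(** At height q ln m the main term of [climbs_prob_ge] is m^(-qb); the correction, at most r^L with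
    L >= m^eta, is eventually less than half of it. *)
Let climb_prob_ge : exists2 k0 : R, 0 < k0 & \forall m \near \oo,
  k0 * m%:R `^ (- (q * b)) <= word_prob p (len m) (climbs v (q * ln m%:R)).
Proof.
have [r0 r1] := andP r01.
pose M := `|log_bound c| + (grid_size c del)%:R * del.
have M0 : 0 <= M by rewrite addr_ge0// mulr_ge0// ltW.
exists (expR (- (b * M)) / 2); first by rewrite divr_gt0 ?expR_gt0.
have qb0 : 0 <= q * b by rewrite mulr_ge0// ltW.
have [L LE] : exists L, L = - ln r by exists (- ln r).
have L0 : 0 < L by rewrite LE oppr_gt0 ln_lt0// r0.
have e2 : 0 < eta / 2 by rewrite divr_gt0.
have e21 : eta / 2 < eta by rewrite ltr_pdivrMr// mulr2n mulrDr !mulr1 ltrDl.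
pose K : R := 1%:R `^ (eta / 2) / (eta / 2).
have N1 := near_powR_le (eta / 2) eta (q * b * K + ln 2) L e21 L0.
near=> m.
have m0 : (0 < m)%N by near: m; exact: nbhs_infty_gt.
have mR : (1 : R) <= m%:R by rewrite ler1n.
have h0 : 0 <= q * ln m%:R by rewrite mulr_ge0 ?ln_ge0// ltW.
have Mh : - M <= q * ln m%:R by apply: le_trans h0; rewrite oppr_le0.
apply: le_trans (climbs_prob_ge p p_ge0 p_sum1 v a b r M (len m) _ a_ge0 ab
  (cell_val_le c del del_gt0) (ltW r0) Mh vb va).
rewrite -mulrA ler_wpM2l ?expR_ge0//.
have -> : m%:R `^ (- (q * b)) = expR (- (b * (q * ln m%:R))) :> R.
  by rewrite /powR gt_eqF ?ltr0n//; congr expR; ring.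
set X := expR (- (b * _)).
suff : r ^+ len m * expR (- (a * (q * ln m%:R))) <= X / 2.
  by move: (_ * _) => Y; lra.
apply: (@le_trans _ _ (r ^+ len m)).
  rewrite ler_piMr ?exprn_ge0 ?(ltW r0)// -[leRHS]expR0 ler_expR oppr_le0.
  by rewrite mulr_ge0.
rewrite -[r in r ^+ _]lnK ?posrE// -expRM_natl -[ln r]opprK -LE.
rewrite -[2]lnK ?posrE// /X -expRB ler_expR mulrN -opprD lerN2.
have H : (q * b * K + ln 2) * m%:R `^ (eta / 2) <= L * m%:R `^ eta by near: m.
have mm : (m <= 1 * m)%N by rewrite mul1n.
have L1 := ln_nat_le (eta / 2) m 1 m e2 m0 mm.
rewrite -/K in L1.
have p1 : 1 <= m%:R `^ (eta / 2) :> R by apply: powR_ge1 => //; exact: ltW.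
have ln20 : 0 <= ln 2 :> R by rewrite ln_ge0// ler1n.
have H2 : ln 2 <= ln 2 * m%:R `^ (eta / 2) :> R by rewrite ler_peMr.
have H3 : q * b * ln m%:R <= q * b * (K * m%:R `^ (eta / 2)) by rewrite ler_wpM2l.
have H4 : L * m%:R `^ eta <= L * (len m)%:R by rewrite ler_wpM2l ?(ltW L0).
rewrite [b * _]mulrCA [X in X + _ <= _]mulrA [leRHS]mulrC.
apply: le_trans H4; apply: le_trans H; rewrite mulrDl.
by apply: lerD H2; apply: le_trans H3 _; rewrite mulrA.
Unshelve. all: by end_near. Qed.

(** All blocks fail with probability at most exp(-pi B) for B blocks, and pi B is at least of order
    m^eta; the power -2 is merely a convenient summable bound. *)
Let fail_le : \forall m \near \oo, (P (fail m) <= (m.+1%:R `^ (- 2))%:E)%E.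
Proof.
have [k0 k00 H] := climb_prob_ge.
have qb0 : 0 <= q * b by rewrite mulr_ge0// ltW.
have e1 : eta < 1 by rewrite /eta; lra.
have e2 : 0 < eta / 2 by rewrite divr_gt0.
have e21 : eta / 2 < eta by rewrite ltr_pdivrMr// mulr2n mulrDr !mulr1 ltrDl.
have k4 : 0 < k0 / 4 by rewrite divr_gt0.
pose K : R := 2%:R `^ (eta / 2) / (eta / 2).
have N1 := near_powR_le (eta / 2) eta (2 * K) (k0 / 4) e21 k4.
have N2 := near_powR_le eta 1 4 1 e1 ltr01.
near=> m.
have m0 : (0 < m)%N by near: m; exact: nbhs_infty_gt.
have mR : (0 : R) < m%:R by rewrite ltr0n.
rewrite (word_law P Hindep Hident (cell c del) mcell _ site_inj _ _) lee_fin no_climb_prob//.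
have : k0 * m%:R `^ (- (q * b)) <= word_prob p (len m) (climbs v (q * ln m%:R)).
  by near: m.
set pi := word_prob p _ _ => pige.
have pi1 : pi <= 1 by exact: (word_prob_le1 p p_ge0 p_sum1).
apply: (@le_trans _ _ (expR (- pi) ^+ blocks m)).
  apply: lerXn2r; rewrite ?nnegrE ?expR_ge0 ?subr_ge0//.
  exact: expR_ge1Dx.
have -> : m.+1%:R `^ (- 2) = expR (- (2 * ln m.+1%:R)) :> R.
  by rewrite /powR gt_eqF ?ltr0n//; congr expR; ring.
rewrite -expRM_natl ler_expR mulrN lerN2.
have mm : (m.+1 <= 2 * m)%N by move: m0; clear; lia.
have L1 := ln_nat_le (eta / 2) m.+1 2 m e2 (ltn0Sn _) mm.
have H1 : 2 * K * m%:R `^ (eta / 2) <= k0 / 4 * m%:R `^ eta by near: m.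
apply: le_trans (_ : _ <= 2 * K * m%:R `^ (eta / 2)) _.
  by rewrite -mulrA ler_wpM2l.
apply: (le_trans H1).
have lm := len_le m m0.
have l0 : (0 < len m)%N by [].
have H2 : 4 * m%:R `^ eta <= 1 * m%:R `^ 1 :> R by near: m.
rewrite mul1r powRr1 ?ler0n// in H2.
have B1 : m%:R < (blocks m).+1%:R * (len m)%:R :> R.
  by rewrite -natrM ltr_nat /blocks; exact: ltn_ceil.
have p_eta : 0 < m%:R `^ eta :> R by rewrite powR_gt0.
have B2 : m%:R / (4 * m%:R `^ eta) <= (blocks m)%:R :> R.
  rewrite ler_pdivrMr ?mulr_gt0//.
  have B3 : (blocks m).+1%:R * (len m)%:R <= (blocks m).+1%:R * (2 * m%:R `^ eta) :> R.
    by rewrite ler_wpM2l.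
  have := lt_le_trans B1 B3; rewrite -[(blocks m).+1%:R]natr1; move: H2.
  move: (m%:R `^ eta) (m%:R) ((blocks m)%:R) => x y z; lra.
apply: (@le_trans _ _ (m%:R / (4 * m%:R `^ eta) * (k0 * m%:R `^ (- (q * b))))); last first.
  apply: ler_pM => //; rewrite ?divr_ge0 ?mulr_ge0 ?powR_ge0 ?(ltW k00)//.
rewrite le_eqVlt; apply/orP; left; apply/eqP.
have -> : m%:R `^ (- (q * b)) = m%:R `^ eta * m%:R `^ eta / m%:R :> R.
  rewrite -[X in _ / X](powRr1 (ltW mR)) -powRD ?pnatr_eq0 -?lt0n ?m0 ?implybT//.
  rewrite -powRB ?pnatr_eq0 -?lt0n ?m0 ?implybT//.
  by congr (_ `^ _); rewrite /eta; lra.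
by field; rewrite !gt_eqF.
Unshelve. all: by end_near. Qed.

(** Borel-Cantelli: almost surely only finitely many m fail. As the grid rounds down, a climb of the
    grid values is a climb of V. *)
Lemma ae_wells_of_cells : {ae P, forall w : environment R, has_wells w q}.
Proof.
have [m0 _ Hm0] := fail_le.
pose F j := fail (j + m0)%N.
have mF j : measurable (F j) by exact: mfail.
have FB j : (P (F j) <= (j.+1%:R `^ (- (1 + 1)))%:E)%E.
  apply: le_trans (Hm0 (j + m0)%N (leq_addl _ _)) _; rewrite lee_fin.
  rewrite (_ : - (1 + 1) = - 2); last by ring.
  rewrite !powRN lef_pV2 ?posrE ?powR_gt0 ?ltr0n//.
  apply: ge0_ler_powR; rewrite ?nnegrE ?ler0n//.
  by rewrite ler_nat ltnS leq_addr.
have lim0 : P (lim_sup_set F) = 0%E.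
  apply: lim_sup_set_cvg0 => //; apply: le_lt_trans (ltry (1 + 1^-1)).
  apply: (nneseries_le (fun j => P (F j)) _ _ _ FB) => // N.
  exact: powR_sum_le.
have N0 : {ae P, forall w : environment R, ~ lim_sup_set F w}.
  exists (lim_sup_set F); split => //; last by move=> w /contrapT.
  apply: bigcapT_measurable => n; exact: bigcup_measurable.
apply: filterS2 N0 ae_elliptic => w nF wc.
have [n0 Hn0] : exists n0, forall j, (n0 <= j)%N -> ~ F j w.
  apply: contrapT => nn; apply: nF => n _; apply: contrapT => nE; apply: nn.
  by exists n => j nj Fj; apply: nE; exists j.
exists (n0 + m0)%N => m mm.
have : ~ fail m w.
  by have := Hn0 (m - m0)%N; rewrite /F subnK; [apply; move: mm; clear; lia|move: mm; clear; lia].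
move/negP; set s := word _ _ _ _ => nc.
have ss : size s = (blocks m * len m)%N by rewrite size_map size_iota.
have [b' [l [bl hl]]] := no_climbPn v _ (len m) (blocks m) s ss nc.
exists b', l; split; first by apply: leq_trans bl _; exact: leq_trunc_div.
apply: (le_trans hl).
have -> : take l (drop b' s) = [seq cell c del (w (i%:Z + 1)) | i <- iota b' l].
  rewrite /s /word -map_drop -map_take drop_iota take_iota add0n.
  by rewrite (minn_idPl _)//; move: bl; clear; lia.
rewrite big_map -[b' in iota b' _]addn0 iotaDl big_map.
rewrite (_ : iota 0 l = index_iota 0 l) ?big_mkord; last by rewrite /index_iota subn0.
apply: ler_sum => i _; rewrite ln_rhoE.
have -> : (b' + i)%N%:Z + 1 = b'%:Z + 1 + i%:Z by clear; lia.
by have /andP[] := cell_bounds c del c_gt0 del_gt0 _ (wc (b'%:Z + 1 + i%:Z)).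
Qed.

End wells.

End almost_sure_environment.

(** * Choice of moments and mesh around kappa *)

Section critical_exponents.
Context {R : realType}.
Variable P : probability (environment R) R.
Hypothesis Hindep :
  mutually_independent P (fun (x : int) (w : environment R) => w x).
Hypothesis Hident :
  identically_distributed P (fun (x : int) (w : environment R) => w x).
Variables (c kappa : R).
Hypothesis c_gt0 : 0 < c.
Hypothesis Hell : forall x : int, P [set w : environment R | c <= w x <= 1 - c] = 1%E.
Hypothesis Hlt : (0 < P [set w : environment R | (w 0 < 2^-1)%R])%E.
Hypothesis kappa_gt0 : 0 < kappa.
Hypothesis Hkappa : (moment P kappa = 1)%E.

Let small_moment a : 0 < a -> a < kappa ->
  exists2 s : R, 0 < s < 1 & (moment P a <= s%:E)%E.
Proof.
move=> a0 ak; have m1 := moment_lt1 P Hlt kappa kappa_gt0 Hkappa a a0 ak.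
have m0 := moment_ge0 P a.
have mfin : moment P a \is a fin_num.
  by rewrite ge0_fin_numE//; apply: lt_le_trans m1 (leey _).
(* The maximum with 1/2 keeps the bound positive, for its logarithm is used later. *)
exists (Num.max (fine (moment P a)) 2^-1).
  rewrite lt_max gt_max; apply/andP; split.
    by apply/orP; right; rewrite invr_gt0.
  apply/andP; split; first by rewrite -lte_fin fineK.
  by rewrite invf_lt1// ltr1n.
by rewrite -[leLHS]fineK// lee_fin le_max lexx.
Qed.

Lemma ae_drift_bound q : kappa^-1 < q -> {ae P, forall w : environment R, drift_bound w q}.
Proof.
move=> kq; have q0 : 0 < q by apply: lt_trans kq; rewrite invr_gt0.
(* 1/q < a < kappa gives both qa > 1 and a moment below 1. *)
pose a := (q^-1 + kappa) / 2.
have qk : q^-1 < kappa by rewrite -[ltRHS]invrK ltf_pV2 ?posrE ?invr_gt0.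
have qi : 0 < q^-1 by rewrite invr_gt0.
have a0 : 0 < a by rewrite /a; lra.
have ak : a < kappa by rewrite /a; lra.
have aq : 1 < q * a.
  have : q^-1 < a by rewrite /a; lra.
  by rewrite -[q^-1]mul1r ltr_pdivrMr// mulrC.
have [s /andP[s0 s1] ms] := small_moment a a0 ak.
have ls : ln s < 0 by rewrite ln_lt0// s0.
(* With this mesh exp(a del) = s^(-1/2): rounding up costs half of the gain, and the remaining
   s^(1/2) is r^2 for r = s^(1/4). *)
pose del := - ln s / (2 * a).
have d0 : 0 < del by rewrite divr_gt0 ?oppr_gt0// mulr_gt0.
pose r := expR (ln s / 4).
have r01 : 0 < r < 1.
  by rewrite expR_gt0 expR_lt1 ltr_pdivrMr// mul0r.
apply: (ae_drift_of_cells P Hindep Hident c c_gt0 Hell a q del r a0 d0 aq r01).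
have mc := cell_moment_le P Hident c del c_gt0 d0 Hell a (ltW a0).
have := le_trans mc ms; rewrite lee_fin => sum_le.
rewrite (eq_bigr (fun k => letter_prob P (cell c del) k * expR (a * cell_val c del k) * expR (a * del))).
  rewrite -mulr_suml; apply: le_trans (ler_wpM2r (expR_ge0 _) sum_le) _.
  rewrite -{1}[s]lnK ?posrE// -expRD /r -expRM_natl ler_expR.
  rewrite le_eqVlt; apply/orP; left; apply/eqP; rewrite /del.
  by field; rewrite gt_eqF.
by move=> k _; rewrite mulrDr expRD mulrA.
Qed.

Lemma ae_has_wells q : 0 < q -> q < kappa^-1 ->
  {ae P, forall w : environment R, has_wells w q}.
Proof.
(* kappa < b < 1/q gives both qb < 1 and a moment above 1. *)
move=> q0 qk; pose b := (kappa + q^-1) / 2.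
have qk' : kappa < q^-1 by rewrite -[ltLHS]invrK ltf_pV2 ?posrE ?invr_gt0.
have kb : kappa < b by rewrite /b; lra.
have b0 : 0 < b by apply: lt_trans kb.
have qb : q * b < 1.
  have : b < q^-1 by rewrite /b; lra.
  by rewrite -[q^-1]mul1r ltr_pdivlMr// mulrC.
(* Any exponent with moment below 1 would do: it controls the climbs left unfinished at the end of a
   block. *)
pose a := kappa / 2.
have a0 : 0 < a by rewrite divr_gt0.
have ak : a < kappa by rewrite /a; move: kappa_gt0; lra.
have ab : a <= b by rewrite ltW// (lt_trans ak).
have [r r01 mr] := small_moment a a0 ak.
have m1 := moment_gt1 P Hlt kappa kappa_gt0 Hkappa b kb.
(* The moment is an extended real; if it is infinite, 2 is taken. *)
have [t t1 mt] : exists2 t : R, 1 < t & (t%:E <= moment P b)%E.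
  move: m1; case: (moment P b) => [t | |] //=.
    by rewrite lte_fin => t1; exists t.
  by move=> _; exists 2; rewrite ?ltr1n// leey.
(* exp(b del) = t, so rounding down costs no more than the excess of the moment over 1. *)
pose del := ln t / b.
have d0 : 0 < del by rewrite divr_gt0// ln_gt0.
apply: (ae_wells_of_cells P Hindep Hident c c_gt0 Hell a b del r q (ltW a0) ab d0 q0 qb r01).
- have mc := cell_moment_ge P Hident c del c_gt0 d0 Hell b (ltW b0).
  have := le_trans mt mc; rewrite lee_fin.
  rewrite (eq_bigr (fun k => letter_prob P (cell c del) k * expR (b * cell_val c del k) * t)).
    by rewrite -mulr_suml ler_pMl// (lt_trans ltr01).
  move=> k _; rewrite mulrDr expRD mulrA /del mulrC [b * _]mulrC divfK ?gt_eqF//.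
  by rewrite lnK ?posrE ?(lt_trans ltr01)// mulrC.
- have mc := cell_moment_le P Hident c del c_gt0 d0 Hell a (ltW a0).
  by have := le_trans mc mr; rewrite lee_fin.
Qed.

Lemma drift_bound_le (w : environment R) q1 q2 : q1 <= q2 -> drift_bound w q1 -> drift_bound w q2.
Proof.
move=> q12 [C [g [g0 H]]]; exists C, g; split => // x l.
apply: (le_trans (H x l)); rewrite lerD2r lerD2l ler_wpM2r// ln_ge0//.
by rewrite lerDl.
Qed.

Lemma has_wells_le (w : environment R) q1 q2 : q1 <= q2 -> has_wells w q2 -> has_wells w q1.
Proof.
move=> q12 [m0 H]; exists m0.+1 => m mm.
have [b [l [bl hl]]] := H m (ltnW mm); exists b, l; split => //.
apply: le_trans hl; rewrite ler_wpM2r// ln_ge0// ler1n.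
by apply: leq_trans mm.
Qed.

Let harmonic_lt (e : R) : 0 < e -> exists j : nat, j.+1%:R^-1 < e.
Proof.
move=> e0; exists (Num.truncn e^-1).
rewrite -[ltRHS]invrK ltf_pV2 ?posrE ?invr_gt0 ?ltr0n//.
exact: truncnS_gt.
Qed.

(** Null sets can be united only over countably many q; monotonicity in q reduces to the sequence
    1/kappa + 1/(j+1). *)
Lemma ae_drift_bound_all :
  {ae P, forall w : environment R, forall q, kappa^-1 < q -> drift_bound w q}.
Proof.
have H : {ae P, forall w : environment R, forall j : nat, drift_bound w (kappa^-1 + j.+1%:R^-1)}.
  apply: ae_foralln => j; apply: ae_drift_bound.
  by rewrite ltrDl invr_gt0 ltr0n.
apply: filterS H => w H q; rewrite -subr_gt0 => /harmonic_lt[j jq].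
by apply: drift_bound_le (H j); rewrite -lerBrDl ltW.
Qed.

Lemma ae_has_wells_all : {ae P, forall w : environment R,
  forall q, 0 < q -> q < kappa^-1 -> has_wells w q}.
Proof.
have H : {ae P, forall w : environment R, forall j : nat,
    0 < kappa^-1 - j.+1%:R^-1 -> has_wells w (kappa^-1 - j.+1%:R^-1)}.
  apply: ae_foralln => j.
  have [pos|npos] := ltP 0 (kappa^-1 - j.+1%:R^-1); last first.
    by apply: nearW => w.
  apply: filterS (ae_has_wells _ pos _) => //.
  by rewrite ltrBlDr ltrDl invr_gt0 ltr0n.
apply: filterS H => w H q q0; rewrite -subr_gt0 => /harmonic_lt[j jq].
have le : q <= kappa^-1 - j.+1%:R^-1 by rewrite lerBrDr addrC -lerBrDr ltW.
exact: has_wells_le le (H j (lt_le_trans q0 le)).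
Qed.

End critical_exponents.

Theorem theorem2p1 (R : realType) (P : probability (environment R) R)
  (Hindep : mutually_independent P (fun (x : int) (w : environment R) => w x))
  (Hident : identically_distributed P (fun (x : int) (w : environment R) => w x))
  (Hell : exists c : R, 0 < c /\
     forall x : int, P [set w : environment R | c <= w x <= 1 - c] = 1%E)
  (Hlog : ('E_P[(fun w : environment R => (ln (rho w 0))%R)] < 0)%E)
  (Hlt : (0 < P [set w : environment R | (w 0 < 2^-1)%R])%E)
  (Hgt : (0 < P [set w : environment R | (2^-1 < w 0)%R])%E)
  (kappa : R) (Hkappa0 : 0 < kappa)
  (Hkappa : ('E_P[(fun w : environment R => (rho w 0 `^ kappa)%R)] = 1)%E)
  (dS : measure_display) (S : measurableType dS)
  (Pq : environment R -> probability S R) (X : nat -> S -> int)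
  (HX : forall w : environment R, quenched_walk w (Pq w) X) :
  {ae P, forall w : environment R, forall beta : R,
    let u := fun n : nat =>
      cond_prob (Pq w)
        [set s | (n%:R : R) `^ beta <= (max_abs X (2 * n) s)%:R]
        [set s | X (2 * n)%N s = 0] in
    (beta < kappa / (kappa + 1) -> u @ \oo --> (1 : R)) /\
    (kappa / (kappa + 1) < beta -> u @ \oo --> (0 : R))}.
Proof.
move: Hkappa; rewrite expectation_rho => Hk.
have [c [c0 Hc]] := Hell.
have H1 := ae_elliptic P c Hc.
have H2 := ae_drift_bound_all P Hindep Hident c kappa c0 Hc Hlt Hkappa0 Hk.
have H3 := ae_has_wells_all P Hindep Hident c kappa c0 Hc Hlt Hkappa0 Hk.
(* The environment properties hold for all q at once, so the exceptional null set does not depend on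
   beta. *)
apply: filterS3 H1 H2 H3 => w wc wd ww beta; split => hb.
  exact: (bridge_near w c kappa c0 wc Hkappa0 wd ww (Pq w) X (HX w) beta hb).
exact: (bridge_far w c kappa c0 wc Hkappa0 wd ww (Pq w) X (HX w) beta hb).
Qed.
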